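(* Let $\mathbb{V}$ be a finite-dimensional real vector space, and let $f:\operatorname{dom} f\rightarrow\mathbb{R}$ be a $C^3$ function with open domain $\operatorname{dom} f \subset \mathbb{V}$. Suppose that for all $x\in\operatorname{dom} f$ and $h\in\mathbb{V}$ such that $x+h$ and $x-h$ both lie in $\operatorname{cl}\operatorname{dom} f$, the function $t \mapsto f(x + th)$ is (defined and) operator convex on $(-1, 1)$. If $G$ is a $\nu$-self-concordant barrier for $\operatorname{cl} \operatorname{dom} f$, then the function $$(t,x) \mapsto -\log(t - f(x)) + G(x),$$ defined on $\mathbb{R}\times\operatorname{dom} f$ (with value $+\infty$ where $t\le f(x)$), is a $(1+\nu)$-self-concordant barrier for $\operatorname{cl}\operatorname{epi} f$, where $\operatorname{epi} f = \{(t,x)\in\mathbb{R}\times\operatorname{dom} f : t\ge f(x)\}$.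
   Context: $\operatorname{cl}$ denotes closure. Operator convexity: for a real function $g$ on an interval $(a,b)$ and a Hermitian matrix $X=\sum_i\lambda_i v_iv_i^*$ (spectral decomposition) with all eigenvalues in $(a,b)$, put $g(X)=\sum_i g(\lambda_i)v_iv_i^*$. The function $g$ is operator convex on $(a,b)$ if for every positive integer $n$ and all $n\times n$ complex Hermitian matrices $X,Y$ with eigenvalues in $(a,b)$, $\lambda g(X)+(1-\lambda)g(Y)\succeq g(\lambda X+(1-\lambda)Y)$ for all $\lambda\in[0,1]$, where $\succeq$ is the Loewner order. Self-concordance: let $F$ be a $C^3$, closed (i.e. with closed epigraph), strictly convex function on a finite-dimensional real vector space, with open domain $\operatorname{dom}F=\{x: F(x)<\infty\}$. $F$ is self-concordant if $|\mathsf{D}^3F(x)[h,h,h]|\le 2(\mathsf{D}^2F(x)[h,h])^{3/2}$ for all $x\in\operatorname{dom}F$ and all directions $h$, where $\mathsf{D}^kF(x)[h_1,\dots,h_k]$ is the $k$-th directional derivative at $x$ along $h_1,\dots,h_k$. It is a $\nu$-self-concordant barrier (for the set $\operatorname{cl}\operatorname{dom}F$) if in addition $2\mathsf{D}F(x)[h]-\mathsf{D}^2F(x)[h,h]\le\nu$ for all $x\in\operatorname{dom}F$ and all $h$. Convention: $-\log s=+\infty$ for $s\le0$. *)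

(* Defs.v *)
From HB Require Import structures.
From mathcomp Require Import all_boot all_order all_algebra.
From mathcomp Require Import spectral sesquilinear.
From mathcomp Require Import complex.
From mathcomp Require Import all_classical all_reals all_analysis.
Set Implicit Arguments.
Unset Strict Implicit.
Unset Printing Implicit Defensive.
Import Order.TTheory GRing.Theory Num.Theory.
Import numFieldNormedType.Exports.
Local Open Scope classical_set_scope.
Local Open Scope ring_scope.
Local Open Scope complex_scope.
Local Open Scope sesquilinear_scope.

(* The topology of a finite-dimensional real vector space does not depend on
   the norm: a norm is part of the structure only as a way to carry it. *)
#[short(type="finNormedModType")]
HB.structure Definition FinNormedModule (R : numFieldType) :=
  { V of NormedModule R V & Vector R V }.
HB.instance Definition _ (R : realType) (n : nat) := NormedModule.on 'rV[R]_n.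

Section OperatorConvexity.
Variable R : realType.

(* The rows of [spectralmx X] are the v_i^*, where X = \sum_i lambda_i v_i v_i^*
   and lambda_i = spectral_diag X 0 i. *)
Definition hermfun (g : R -> R) n (X : 'M[R[i]]_n) : 'M[R[i]]_n :=
  (spectralmx X)^t*
    *m diag_mx (map_mx (fun z : R[i] => (g (complex.Re z))%:C) (spectral_diag X))
    *m spectralmx X.

Definition psdmx n (A : 'M[R[i]]_n) : Prop :=
  A \is hermsymmx /\ forall v : 'cV[R[i]]_n, 0 <= (v^t* *m A *m v) 0 0.

Definition loewner_le n (A B : 'M[R[i]]_n) : Prop := psdmx (B - A).

(* The order of R[i] only compares numbers with equal imaginary parts. *)
Definition eigenvalues_in (a b : R) n (X : 'M[R[i]]_n) : Prop :=
  forall z : R[i], eigenvalue X z -> a%:C < z < b%:C.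

Definition operator_convex (a b : R) (g : R -> R) : Prop :=
  forall n : nat, (0 < n)%N -> forall X Y : 'M[R[i]]_n,
    X \is hermsymmx -> Y \is hermsymmx ->
    eigenvalues_in a b X -> eigenvalues_in a b Y ->
    forall l : R, 0 <= l <= 1 ->
      loewner_le (hermfun g (l%:C *: X + (1 - l)%:C *: Y))
                 (l%:C *: hermfun g X + (1 - l)%:C *: hermfun g Y).

End OperatorConvexity.

Section SelfConcordance.
Variables (R : realType) (V : normedModType R).
Implicit Types (F : V -> \bar R) (D K : set V) (f : V -> R).

(* Meant for an open D in finite dimension, where continuity of the derivative
   amounts to continuity of all directional derivatives. *)
Fixpoint Ck (k : nat) D f : Prop :=
  match k with
  | 0 => forall x, D x -> {for x, continuous f}
  | k'.+1 => (forall x, D x -> differentiable f x) /\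
             forall h : V, Ck k' D ('D_h f)
  end.

Definition edom F : set V := [set x | (F x < +oo)%E].

Definition epi F : set (R * V) := [set p | (F p.2 <= p.1%:E)%E].

Definition strictly_convex F : Prop :=
  forall x y (l : R), edom F x -> edom F y -> x != y -> 0 < l < 1 ->
    (F (l *: x + (1 - l) *: y)%R < l%:E * F x + (1 - l)%R%:E * F y)%E.

Record self_concordant F : Prop := SelfConcordant {
  sc_proper : forall x, F x != -oo%E;
  sc_open_dom : open (edom F);
  sc_C3 : Ck 3 (edom F) (fine \o F);
  sc_closed : closed (epi F);
  sc_strictly_convex : strictly_convex F;
  sc_ineq : forall x h, edom F x ->
    `|'D_h ('D_h ('D_h (fine \o F))) x|
      <= 2 * ('D_h ('D_h (fine \o F)) x) `^ (3 / 2) }.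

Definition sc_barrier (nu : R) F K : Prop :=
  [/\ self_concordant F,
      closure (edom F) = K &
      forall x h, edom F x ->
        2 * 'D_h (fine \o F) x - 'D_h ('D_h (fine \o F)) x <= nu].

Definition epi_on D f : set (R * V) := [set p | D p.2 /\ f p.2 <= p.1].

End SelfConcordance.

(* Main.v *)
Require Import Defs.
From HB Require Import structures.
From mathcomp Require Import all_boot all_order all_algebra.
From mathcomp Require Import spectral sesquilinear.
From mathcomp Require Import complex ring lra.
From mathcomp Require Import all_classical all_reals all_analysis.
Set Implicit Arguments.
Unset Strict Implicit.
Unset Printing Implicit Defensive.
Import Order.TTheory GRing.Theory Num.Theory.
Import numFieldNormedType.Exports.
Local Open Scope classical_set_scope.
Local Open Scope ring_scope.

(** Nesterov-Nemirovskii compatibility.  If x + h and x - h lie in the closure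
    of D, then t |-> f(x + t h) is operator convex on (-1, 1), and such a g
    satisfies g'''(0) <= 3 g''(0).  By Dikin's theorem x + r h and x - r h lie
    in D as soon as r^2 D^2G(x)[h,h] < 1, so that by homogeneity
    |D^3f(x)[h,h,h]| <= 3 D^2f(x)[h,h] (D^2G(x)[h,h])^(1/2).  With a = |u'/u|
    for u = t - f(x), w = D^2f/u and b = (D^2G)^(1/2), self-concordance of the
    barrier is then 3 w (a + b) + 2 a^3 + 2 b^3 <= 2 (a^2 + b^2 + w)^(3/2).

    The bound on g''' needs no integral representation.  Pinching a 3 x 3 real
    symmetric matrix with spectrum {-e, e, s + e} to its diagonal (0, s, e) and
    letting e tend to 0 gives, in divided differences,
    g[0,0,0] - 2 th g[0,0,s] + th^2 g[0,s,s] >= 0 for 0 < s < 1 and all th.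
    If th = 1 - s/t, this says that (1 - s/t)^2 g[0,0,s]/s - g[0,0,0]/s is
    nondecreasing in s on (0, t]; comparing its value at t with its expansion
    at 0 yields t g'''(0) <= 3 g''(0) for every t < 1. *)

(** * Operator convexity on 3 x 3 real symmetric matrices *)

Section Spectral.
Local Open Scope complex_scope.
Local Open Scope sesquilinear_scope.

(** Conjugation by the unitary eigenbasis makes both sides diagonal, where only the values on the
    spectrum count. Trading [g] for an interpolating polynomial makes the functional calculus
    computable without knowing the eigenbasis selected by [spectralmx]. *)
Lemma horner_mx_spectral (C : numClosedFieldType) n (X : 'M[C]_n.+1)
    (g : C -> C) (P : {poly C}) :
  X \is normalmx -> (forall z, eigenvalue X z -> P.[z] = g z) ->
  (spectralmx X)^t* *m diag_mx (map_mx g (spectral_diag X)) *m spectralmx X =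
  horner_mx X P.
Proof.
move=> /orthomx_spectralP XE Pg.
set U := spectralmx X in XE *; set d := spectral_diag X in XE *.
have Uu : U \is unitarymx by exact: spectral_unitarymx.
have Uunit := unitarymx_unit Uu.
have UX : U *m X = diag_mx d *m U by rewrite XE !mulmxA mulmxV// mul1mx.
have dP i : P.[d 0 i] = g (d 0 i).
  apply: Pg; apply/eigenvalueP; exists (row i U).
    by rewrite -row_mul UX row_mul row_diag_mx -scalemxAl -rowE.
  apply/negP => /eqP r0.
  have : row i U *m invmx U = 0 by rewrite r0 mul0mx.
  rewrite -row_mul mulmxV// => /matrixP/(_ 0 i)/eqP.
  by rewrite !mxE eqxx oner_eq0.
have -> : horner_mx X P = invmx U *m diag_mx (map_mx (horner P) d) *m U.
  have {1}-> : X = invmx U *m diag_mx d *m invmx (invmx U) by rewrite invmxK.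
  by rewrite horner_mx_uconj ?unitmx_inv// horner_mx_diag invmxK.
rewrite invmx_unitary//; congr (_ *m diag_mx _ *m _).
by apply/rowP => i; rewrite !mxE dP.
Qed.

Variable R : realType.
Local Notation toC := (real_complex R).

Lemma hermfun_horner (g : R -> R) n (X : 'M[R[i]]_n.+1) (P : {poly R[i]}) :
  X \is hermsymmx ->
  (forall z, eigenvalue X z -> P.[z] = (g (complex.Re z))%:C) ->
  hermfun g X = horner_mx X P.
Proof. by move=> /hermitian_normalmx; exact: horner_mx_spectral. Qed.

Lemma eigenvalue_annihilated n (X : 'M[R[i]]_n.+1) (Q : {poly R[i]}) z :
  horner_mx X Q = 0 -> eigenvalue X z -> root Q z.
Proof.
move=> XQ; rewrite eigenvalue_root_min !root_factor_theorem => zX.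
by apply: (dvdp_trans zX); exact: mxminpoly_min.
Qed.

(** The spectrum of a real matrix is controlled through a split real polynomial that annihilates it;
    [s] may contain numbers that are not eigenvalues. *)
Lemma eigenvalue_toC n (A : 'M[R]_n.+1) (s : seq R) z :
  horner_mx A (\prod_(l <- s) ('X - l%:P)) = 0 ->
  eigenvalue (map_mx toC A) z -> exists2 l, l \in s & z = l%:C.
Proof.
move=> As /eigenvalue_annihilated.
move=> /(_ (map_poly toC (\prod_(l <- s) ('X - l%:P)))).
rewrite -map_horner_mx As map_mx0 => /(_ erefl).
rewrite rmorph_prod /= /root horner_prod prodf_seq_eq0 => /hasP[l ls] /=.
rewrite rmorphB /= map_polyX map_polyC /= -/(root _ z) root_XsubC => /eqP ->.
by exists l.
Qed.

Lemma conjmx_toC m n (A : 'M[R]_(m, n)) :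
  map_mx Num.conj (map_mx toC A) = map_mx toC A.
Proof.
by apply/matrixP => i j; rewrite !mxE -[LHS]/(conjc _) conjc_real.
Qed.

Lemma hermsymmx_toC n (A : 'M[R]_n) : A^T = A -> map_mx toC A \is hermsymmx.
Proof.
move=> AT; apply/is_hermitianmxP; rewrite expr0 scale1r.
by rewrite -map_trmx conjmx_toC map_trmx AT.
Qed.

Lemma hermfun_toC (g : R -> R) n (A : 'M[R]_n.+1) (s : seq R) (P : {poly R}) :
  A^T = A -> horner_mx A (\prod_(l <- s) ('X - l%:P)) = 0 ->
  (forall l, l \in s -> P.[l] = g l) ->
  hermfun g (map_mx toC A) = map_mx toC (horner_mx A P).
Proof.
move=> AT As Pg; rewrite map_horner_mx; apply: hermfun_horner.
  exact: hermsymmx_toC.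
move=> z /(eigenvalue_toC As)[l ls ->].
by rewrite horner_map /= Pg.
Qed.

(** Operator convexity at weight 1/2, carried from complex Hermitian to real symmetric matrices and
    tested on one real vector. The polynomials [P] and [Q] stand for [g] on the respective
    spectra. *)
Lemma operator_convex_midpoint (a b : R) (g : R -> R) n
    (X Y Z : 'M[R]_n.+1) (s r : seq R) (P Q : {poly R}) (v : 'cV[R]_n.+1) :
  operator_convex a b g ->
  X^T = X -> Y^T = Y -> X + Y = 2 *: Z ->
  horner_mx X (\prod_(l <- s) ('X - l%:P)) = 0 ->
  horner_mx Y (\prod_(l <- s) ('X - l%:P)) = 0 ->
  horner_mx Z (\prod_(l <- r) ('X - l%:P)) = 0 ->
  (forall l, l \in s -> a < l < b) ->
  (forall l, l \in s -> P.[l] = g l) ->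
  (forall l, l \in r -> Q.[l] = g l) ->
  (v^T *m horner_mx Z Q *m v) 0 0 *+ 2 <=
  (v^T *m horner_mx X P *m v) 0 0 + (v^T *m horner_mx Y P *m v) 0 0.
Proof.
move=> og XT YT XYZ Xs Ys Zr sab Ps Qr.
have ZT : Z^T = Z.
  have : 2 *: Z^T = 2 *: Z.
    by rewrite -XYZ -linearZ /= -XYZ linearD /= XT YT.
  by apply: (@scalerI R _ 2); rewrite pnatr_eq0.
have ein (A : 'M[R]_n.+1) : horner_mx A (\prod_(l <- s) ('X - l%:P)) = 0 ->
    eigenvalues_in a b (map_mx toC A).
  by move=> As z /(eigenvalue_toC As)[l /sab lab ->]; rewrite !ltcR.
have /= := og n.+1 isT (map_mx toC X) (map_mx toC Y) (hermsymmx_toC XT)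
  (hermsymmx_toC YT) (ein _ Xs) (ein _ Ys) 2^-1.
rewrite invr_ge0 ler0n invf_le1 ?ltr0n// ler1n => /(_ isT).
have -> : (1 - 2^-1 : R) = 2^-1 by field.
rewrite -scalerDr -map_mxD XYZ -map_mxZ scalerA mulVf ?pnatr_eq0// scale1r.
rewrite (hermfun_toC XT Xs Ps) (hermfun_toC YT Ys Ps) (hermfun_toC ZT Zr Qr).
rewrite /loewner_le /psdmx -!map_mxZ -map_mxD -map_mxB.
move=> -[_ /(_ (map_mx toC v))].
rewrite -map_trmx conjmx_toC map_trmx -!map_mxM mxE ler0c.
rewrite mulmxBr mulmxBl mulmxDr mulmxDl -!scalemxAr -!scalemxAl !mxE.
by move=> h; lra.
Qed.

(** Newton's scheme: a new node is fitted by adding a multiple of the product that vanishes at the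
    earlier ones. *)
Lemma interpolation_exists (g : R -> R) (s : seq R) :
  exists P : {poly R}, forall l, l \in s -> P.[l] = g l.
Proof.
elim: s => [|x s [P Ps]]; first by exists 0.
have [xs|xs] := boolP (x \in s).
  by exists P => l; rewrite inE => /predU1P[->|/Ps//]; exact: Ps.
pose w : {poly R} := \prod_(l <- s) ('X - l%:P).
have w0 : w.[x] != 0 by rewrite -/(root w x) root_prod_XsubC.
exists (P + ((g x - P.[x]) / w.[x])%:P * w) => l.
rewrite inE !hornerE => /predU1P[->|ls]; first by rewrite divfK// addrC subrK.
have /eqP -> : root w l by rewrite root_prod_XsubC.
by rewrite mulr0 addr0 Ps.
Qed.

Definition arrow_mx (a b c p q : R) : 'M[R]_3 :=
  \matrix_(i, j)
    nth 0 (nth [::] [:: [:: a; 0; p]; [:: 0; b; q]; [:: p; q; c]] i) j.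

Lemma arrow_mx_sym (a b c p q : R) :
  (arrow_mx a b c p q)^T = arrow_mx a b c p q.
Proof.
by apply/matrixP => -[[|[|[|//]]] ?] [[|[|[|//]]] ?]; rewrite !mxE.
Qed.

Lemma horner_mx_quadratic n (A : 'M[R]_n.+1) (c0 c1 c2 : R) :
  horner_mx A (c2 *: 'X ^+ 2 + c1 *: 'X + c0%:P) =
  c2 *: (A *m A) + c1 *: A + c0%:M.
Proof.
by rewrite !rmorphD /= !horner_mxZ rmorphXn /= horner_mx_X horner_mx_C.
Qed.

(** Since the last coordinate of [v] is 0, only the upper left block contributes, and there [p] and
    [q] enter only through the square of the matrix. *)
Lemma arrow_mx_quad (a b c p q c0 c1 c2 x y : R) :
  let v : 'cV[R]_3 := \col_i [:: x; y; 0]`_i in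
  (v^T *m horner_mx (arrow_mx a b c p q)
            (c2 *: 'X ^+ 2 + c1 *: 'X + c0%:P) *m v) 0 0 =
  (c2 * a ^+ 2 + c1 * a + c0) * x ^+ 2 + (c2 * b ^+ 2 + c1 * b + c0) * y ^+ 2
  + c2 * (p * x + q * y) ^+ 2.
Proof.
move=> v; rewrite horner_mx_quadratic.
rewrite !mxE !big_ord_recl !big_ord0 !mxE.
rewrite !big_ord_recl !big_ord0 !mxE /=.
rewrite !big_ord_recl !big_ord0 !mxE /=.
by ring.
Qed.

(** The hypotheses match the elementary symmetric functions of the [l]'s with the coefficients of
    the characteristic polynomial, so this is Cayley-Hamilton, checked entry by entry. *)
Lemma arrow_mx_annihilated (a b c p q l1 l2 l3 : R) :
  l1 + l2 + l3 = a + b + c ->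
  l1 * l2 + l1 * l3 + l2 * l3 = a * b + a * c + b * c - p ^+ 2 - q ^+ 2 ->
  l1 * l2 * l3 = a * b * c - p ^+ 2 * b - q ^+ 2 * a ->
  horner_mx (arrow_mx a b c p q) (\prod_(l <- [:: l1; l2; l3]) ('X - l%:P)) = 0.
Proof.
move=> e1 e2 e3.
have -> : \prod_(l <- [:: l1; l2; l3]) ('X - l%:P) =
    'X ^+ 3 - (l1 + l2 + l3) *: 'X ^+ 2
    + (l1 * l2 + l1 * l3 + l2 * l3) *: 'X - (l1 * l2 * l3)%:P :> {poly R}.
  by rewrite !big_cons big_nil -!mul_polyC !(polyCD, polyCM); ring.
set A := arrow_mx _ _ _ _ _.
rewrite !(rmorphB, rmorphD) /= !horner_mxZ !rmorphXn /= horner_mx_X horner_mx_C.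
rewrite e1 e2 e3 exprS expr2 -[A * (A * A)]/(A *m (A *m A)) -[A * A]/(A *m A).
apply/matrixP => i j; do !rewrite !mxE ?big_ord_recl ?big_ord0.

by case: i => -[|[|[|//]]] ?; case: j => -[|[|[|//]]] ? /=; ring.
Qed.

(* Flipping the signs of [p] and [q] preserves the spectrum [l1, l2, l3] of the
   arrow matrix, and the mean of both matrices is diagonal. *)
Lemma operator_convex_compression (lo hi : R) (g : R -> R)
    (a b c p q l1 l2 l3 c0 c1 c2 x y : R) :
  operator_convex lo hi g ->
  l1 + l2 + l3 = a + b + c ->
  l1 * l2 + l1 * l3 + l2 * l3 = a * b + a * c + b * c - p ^+ 2 - q ^+ 2 ->
  l1 * l2 * l3 = a * b * c - p ^+ 2 * b - q ^+ 2 * a ->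
  (forall l, l \in [:: l1; l2; l3] ->
     lo < l < hi /\ c2 * l ^+ 2 + c1 * l + c0 = g l) ->
  g a * x ^+ 2 + g b * y ^+ 2 <=
    (c2 * a ^+ 2 + c1 * a + c0) * x ^+ 2 + (c2 * b ^+ 2 + c1 * b + c0) * y ^+ 2
    + c2 * (p * x + q * y) ^+ 2.
Proof.
move=> og e1 e2 e3 gl.
pose P : {poly R} := c2 *: 'X ^+ 2 + c1 *: 'X + c0%:P.
have PE z : P.[z] = c2 * z ^+ 2 + c1 * z + c0 by rewrite /P !hornerE.
have [Q Qg] := interpolation_exists g [:: a; b; c].
pose d : 'rV[R]_3 := \row_i [:: a; b; c]`_i.
have := @operator_convex_midpoint lo hi g 2 (arrow_mx a b c p q)
  (arrow_mx a b c (- p) (- q)) (diag_mx d) [:: l1; l2; l3] [:: a; b; c] P Q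
  (\col_i [:: x; y; 0]`_i) og (arrow_mx_sym _ _ _ _ _) (arrow_mx_sym _ _ _ _ _).
rewrite !arrow_mx_quad !horner_mx_diag.
rewrite [X in X *+ 2 <= _](_ : _ = g a * x ^+ 2 + g b * y ^+ 2); last first.
- do !rewrite !mxE ?big_ord_recl ?big_ord0.
  by rewrite /= !Qg ?inE ?eqxx ?orbT//; ring.
rewrite (_ : - p * x + - q * y = - (p * x + q * y)); last by ring.
rewrite sqrrN => h.
suff : (g a * x ^+ 2 + g b * y ^+ 2) *+ 2 <=
   ((c2 * a ^+ 2 + c1 * a + c0) * x ^+ 2
    + (c2 * b ^+ 2 + c1 * b + c0) * y ^+ 2 + c2 * (p * x + q * y) ^+ 2) *+ 2.
  by rewrite ler_pMn2r.
rewrite [leRHS]mulr2n; apply: h.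
- by apply/matrixP => -[[|[|[|//]]] ?] [[|[|[|//]]] ?]; rewrite !mxE /=; ring.
- exact: arrow_mx_annihilated.
- by apply: arrow_mx_annihilated; rewrite ?sqrrN.
- apply/matrixP => i j; rewrite !mxE.
  rewrite [X in X *+ _](_ : _ = 0) ?mul0rn//.
  by apply/eqP; rewrite -/(root _ _) root_prod_XsubC mem_nth.
- by move=> l /gl[].
- by move=> l /gl[_]; rewrite PE.
- exact: Qg.
Qed.

End Spectral.

(** * Derivatives of operator convex functions *)

Section DividedDifferences.
Variable R : realType.
Implicit Types g : R -> R.

(* [T] is the divided difference of [g] at the nodes [- e], [e], [S], and
   [z |-> m + d * z] interpolates [g] at [- e] and [e]. *)
Lemma operator_convex_divided_differences g (s e th S m d D dq T : R) :
  operator_convex (-1) 1 g -> 0 < e -> e < s -> s + e < 1 ->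
  S = s + e ->
  m = (g e + g (- e)) / 2 ->
  d = (g e - g (- e)) / (2 * e) ->
  D = (g e + g (- e) - 2 * g 0) / e ^+ 2 ->
  dq = (g S - g s) / e ->
  T = (g S - m - d * S) / (S ^+ 2 - e ^+ 2) ->
  0 <= (D / 2 - T) * s / S + T * (1 - th) ^+ 2
    + th ^+ 2 * s * ((dq - d) / (S ^+ 2 - e ^+ 2)
      - (g s - m - d * s) * (2 * s + e)
          / ((S ^+ 2 - e ^+ 2) * (s ^+ 2 - e ^+ 2))).
Proof.
move=> og e0 es Slt1 SE mE dE DE dqE TE.
have s0 : 0 < s by exact: lt_trans es.
have S0 : 0 < S by rewrite SE addr_gt0.
have se0 : 0 < s ^+ 2 - e ^+ 2 by rewrite subr_gt0 ltr_pXn2r// nnegrE ltW.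
have Se0 : 0 < S ^+ 2 - e ^+ 2.
  by rewrite subr_gt0 ltr_pXn2r ?nnegrE ?ltW// SE ltrDr.
have pp : 0 < e ^+ 2 * S / s by rewrite divr_gt0// mulr_gt0// exprn_gt0.
have qp : 0 < (s ^+ 2 - e ^+ 2) * e / s by rewrite divr_gt0// mulr_gt0.
(* With these entries the arrow matrix has spectrum [- e, e, S]. *)
pose p := Num.sqrt (e ^+ 2 * S / s).
pose q := Num.sqrt ((s ^+ 2 - e ^+ 2) * e / s).
have p0 : p != 0 by rewrite sqrtr_eq0 -ltNge.
have q0 : q != 0 by rewrite sqrtr_eq0 -ltNge.
have p2 : p ^+ 2 = e ^+ 2 * S / s by rewrite sqr_sqrtr// ltW.
have q2 : q ^+ 2 = (s ^+ 2 - e ^+ 2) * e / s by rewrite sqr_sqrtr// ltW.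
have en0 : e != 0 by rewrite gt_eqF.
have sn0 : s != 0 by rewrite gt_eqF.
have Sn0 : S != 0 by rewrite gt_eqF.
have sen0 : s ^+ 2 - e ^+ 2 != 0 by rewrite gt_eqF.
have Sen0 : S ^+ 2 - e ^+ 2 != 0 by rewrite gt_eqF.
(* The quadratic is the Newton form m + d l + T (l^2 - e^2) of the interpolant of [g] at [- e], [e],
   [S]. The test vector (1/p, - th/q) gives the coupling term p x + q y the value 1 - th. *)
have := @operator_convex_compression R (-1) 1 g 0 s e p q (- e) e S
  (m - T * e ^+ 2) d T p^-1 (- th / q) og.
have e1 : - e + e + S = 0 + s + e by rewrite SE; ring.
have e2 : - e * e + - e * S + e * S = 0 * s + 0 * e + s * e - p ^+ 2 - q ^+ 2.
  by rewrite p2 q2 SE; field.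
have e3 : - e * e * S = 0 * s * e - p ^+ 2 * s - q ^+ 2 * 0.
  by rewrite p2 q2 SE; field.
have gl l : l \in [:: - e; e; S] ->
    -1 < l < 1 /\ T * l ^+ 2 + d * l + (m - T * e ^+ 2) = g l.
  rewrite !inE => /or3P[] /eqP ->; split.
  - by apply/andP; split; lra.
  - by rewrite mE dE; field.
  - by apply/andP; split; lra.
  - by rewrite mE dE; field.
  - by apply/andP; split; rewrite SE; lra.
  - by rewrite TE; field.
move=> /(_ e1 e2 e3 gl).
have -> : p * p^-1 + q * (- th / q) = 1 - th by field; rewrite p0 q0.
rewrite exprMn !exprVn sqrrN p2 q2 -subr_ge0; congr (0 <= _).
rewrite TE DE dqE mE dE; rewrite SE in Sn0 Sen0 *; field.
by rewrite sen0 Sen0 en0 Sn0 sn0.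
Qed.

End DividedDifferences.

(** * Confluent limit of the divided differences: Kraus' inequality *)

Section KrausInequality.
Variable R : realType.
Implicit Types g : R -> R.

Lemma is_derive_cvg_dnbhs g (x v : R) : is_derive x 1 g v ->
  (g (x + e) - g x) / e @[e --> 0^'] --> v.
Proof.
move=> [dgx <-]; apply: cvg_trans dgx; apply: near_eq_cvg; near=> e.
by rewrite /= [e%:A]mulr1 [e + x]addrC; exact: mulrC.
Unshelve. all: by end_near. Qed.

Lemma is_derive_central_difference g (x v : R) : is_derive x 1 g v ->
  (g (x + e) - g (x - e)) / (2 * e) @[e --> 0^'+] --> v.
Proof.
move=> /is_derive_cvg_dnbhs dg.
have gr := cvg_dnbhs_at_right dg.
have /cvg_at_leftNP := cvg_dnbhs_at_left dg; rewrite oppr0 => gl.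
have -> : v = (v + v) / 2 by field.
apply: cvg_trans (cvgM (cvgD gr gl) (cvg_cst (2^-1 : R))).
apply: near_eq_cvg; near=> e; rewrite /= !fctE /=.
have e0 : e != 0 by near: e; exact: nbhs_right_neq.
by field.
Unshelve. all: by end_near. Qed.

Lemma second_difference g g1 (r k : R) : 0 < r ->
  (forall x : R, - r < x < r -> is_derive x 1 g (g1 x)) ->
  is_derive (0 : R) 1 g1 k ->
  (g e + g (- e) - 2 * g 0) / e ^+ 2 @[e --> 0^'+] --> k.
Proof.
move=> r0 dg /is_derive_central_difference dg1.
have dgN (x : R) : - r < x < r -> is_derive x 1 (fun x => g (- x)) (- g1 (- x)).
  move=> x1; have dgx : is_derive (- x) 1 g (g1 (- x)) by apply: dg; lra.
  have := @is_derive1_comp _ g -%R x _ _ dgx (is_deriveNid _ _).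
  by rewrite mulrN1.
have gc (x : R) : - r < x < r -> {for x, continuous g}.
  move=> /dg dgx; apply/differentiable_continuous/derivable1_diffP.
  exact: ex_derive.
have c0 : {for 0, continuous (fun e => g e + g (- e) - 2 * g 0)}.
  apply: cvgB; last exact: cvg_cst.
  apply: cvgD; first by apply: gc; lra.
  apply: continuous_comp; first exact: opp_continuous.
  by rewrite oppr0; apply: gc; lra.
(* One use of l'Hopital's rule suffices: the quotient of the derivatives is the central difference
   of [g1] at 0. *)
refine (@lhopital_at_right R (fun e => g e + g (- e) - 2 * g 0)
  (fun e => g1 e - g1 (- e)) (fun e => e ^+ 2) (fun e => 2 * e) 0 r k r0
  _ _ _ _ _ _).
- move=> x; rewrite in_itv/= => x01.
  have := dg x ltac:(lra); have := dgN x ltac:(lra) => dgNx dgx.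
  by apply: is_derive_eq; rewrite subr0.
- move=> x _; apply: is_derive_eq.
  by rewrite [x%:A]mulr1 mulr_natl mulr2n.
- move: c0 => /cvg_at_right_filter; rewrite oppr0.
  by rewrite (_ : g 0 + g 0 - 2 * g 0 = 0)//; ring.
- have /cvg_at_right_filter := @exprn_continuous R 2 0.
  by rewrite expr0n.
- by move=> x; rewrite in_itv/= => /andP[x0 _]; rewrite mulf_neq0// gt_eqF.
- by move: dg1; under eq_fun do rewrite add0r sub0r.
Qed.

(* The quadratic form at [(1, - th)] of Kraus' matrix, whose entries are the
   divided differences g[0,0,0], g[0,0,s] and g[0,s,s]. *)
Lemma operator_convex_kraus g g1 (k s th : R) :
  operator_convex (-1) 1 g ->
  (forall x : R, -1 < x < 1 -> is_derive x 1 g (g1 x)) ->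
  is_derive (0 : R) 1 g1 k ->
  0 < s < 1 ->
  0 <= k / 2 - 2 * th * ((g s - g 0 - g1 0 * s) / s ^+ 2)
       + th ^+ 2 * ((g1 s - (g s - g 0) / s) / s).
Proof.
move=> og dg dg1 s01.
have /andP[s0 s1] := s01.
pose m (e : R) := (g e + g (- e)) / 2.
pose d (e : R) := (g e - g (- e)) / (2 * e).
pose D (e : R) := (g e + g (- e) - 2 * g 0) / e ^+ 2.
pose dq (e : R) := (g (s + e) - g s) / e.
pose T (e : R) := (g (s + e) - m e - d e * (s + e)) / ((s + e) ^+ 2 - e ^+ 2).
have gc (x : R) : -1 < x < 1 -> {for x, continuous g}.
  move=> /dg dgx; apply/differentiable_continuous/derivable1_diffP.
  exact: ex_derive.
have mc : m e @[e --> 0^'+] --> g 0.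
  have -> : g 0 = (g 0 + g (- 0)) / 2 by rewrite oppr0; field.
  apply: cvg_at_right_filter; apply: cvgM; last exact: cvg_cst.
  apply: cvgD; first by apply: gc; lra.
  apply: (@continuous_comp _ _ _ -%R g); first exact: opp_continuous.
  by rewrite oppr0; apply: gc; lra.
have dc : d e @[e --> 0^'+] --> g1 0.
  have := @is_derive_central_difference g 0 _ (dg 0 ltac:(lra)).
  by under eq_fun do rewrite add0r sub0r.
have Dc : D e @[e --> 0^'+] --> k by exact: second_difference ltr01 dg dg1.
have dqc : dq e @[e --> 0^'+] --> g1 s.
  by apply/cvg_dnbhs_at_right/is_derive_cvg_dnbhs/dg; lra.
have ec : e @[e --> (0:R)^'+] --> (0:R).
  by apply: cvg_at_right_filter; exact: cvg_id.
have e2c : e ^+ 2 @[e --> (0:R)^'+] --> (0:R).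
  by have /cvg_at_right_filter := @exprn_continuous R 2 0; rewrite expr0n.
have Sc : s + e @[e --> (0:R)^'+] --> s.
  by rewrite -[X in _ --> X]addr0; apply: cvgD => //; exact: cvg_cst.
have gSc : g (s + e) @[e --> (0:R)^'+] --> g s.
  apply: (@continuous_cvg _ _ _ _ _ (fun e => s + e) g s) => //.
  by apply: gc; lra.
have sec : s ^+ 2 - e ^+ 2 @[e --> (0:R)^'+] --> s ^+ 2.
  by rewrite -[X in _ --> X]subr0; apply: cvgB => //; exact: cvg_cst.
have Sec : (s + e) ^+ 2 - e ^+ 2 @[e --> (0:R)^'+] --> s ^+ 2.
  by rewrite -[X in _ --> X]subr0; apply: cvgB => //; exact: cvgM.
have sn0 : s != 0 by rewrite gt_eqF.
have s2n0 : s ^+ 2 != 0 by rewrite sqrf_eq0.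
pose rho := (g s - g 0 - g1 0 * s) / s ^+ 2.
have Tc : T e @[e --> 0^'+] --> rho.
  by apply: cvgM; [apply: cvgB; [exact: cvgB|exact: cvgM]|exact: cvgV].
(* [E e] is the quantity shown nonnegative by the divided difference inequality; its limit as [e]
   decreases to 0 simplifies to the stated form. *)
pose E e := (D e / 2 - T e) * s / (s + e) + T e * (1 - th) ^+ 2
    + th ^+ 2 * s * ((dq e - d e) / ((s + e) ^+ 2 - e ^+ 2)
      - (g s - m e - d e * s) * (2 * s + e)
          / (((s + e) ^+ 2 - e ^+ 2) * (s ^+ 2 - e ^+ 2))).
have Ec : E e @[e --> 0^'+] --> (k / 2 - rho) * s / s + rho * (1 - th) ^+ 2
    + th ^+ 2 * s * ((g1 s - g1 0) / s ^+ 2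
      - (g s - g 0 - g1 0 * s) * (2 * s + 0) / (s ^+ 2 * s ^+ 2)).
  have cc (c : R) : c @[_ --> (0:R)^'+] --> c by exact: cvg_cst.
  apply: cvgD; first apply: cvgD.
  - apply: cvgM; last exact: cvgV.
    by apply: cvgM => //; apply: cvgB => //; exact: cvgM.
  - exact: cvgM.
  - apply: cvgM => //; apply: cvgB.
      by apply: cvgM; [exact: cvgB|exact: cvgV].
    apply: cvgM; last by apply: cvgV; [rewrite mulf_neq0|exact: cvgM].
    apply: cvgM; first by apply: cvgB; [exact: cvgB|exact: cvgM].
    by apply: cvgD.
have <- : (k / 2 - rho) * s / s + rho * (1 - th) ^+ 2
    + th ^+ 2 * s * ((g1 s - g1 0) / s ^+ 2
      - (g s - g 0 - g1 0 * s) * (2 * s + 0) / (s ^+ 2 * s ^+ 2)) =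
    k / 2 - 2 * th * rho + th ^+ 2 * ((g1 s - (g s - g 0) / s) / s).
  by rewrite /rho; field.
apply: (cvgr_to_ge Ec); near=> e.
apply: (@operator_convex_divided_differences _ g s e th (s + e)
  _ _ _ _ _ og) => //.
rewrite -ltrBrDl; near: e; apply: nbhs_right_lt; lra.
Unshelve. all: by end_near. Qed.

End KrausInequality.

(** * The bound on the third derivative at 0 *)

Section ThirdDerivative.
Variable R : realType.
Implicit Types g : R -> R.

Lemma is_derive_MVT g g1 (a b : R) : a <= b ->
  (forall x : R, a <= x <= b -> is_derive x 1 g (g1 x)) ->
  exists2 c, a <= c <= b & g b - g a = g1 c * (b - a).
Proof.
move=> ab dg.
have [|||c cab ->] := @MVT_segment R g g1 a b.
- exact: ab.
- move=> x; rewrite in_itv/= => /andP[ax xb].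
  by apply: dg; rewrite !ltW.
- apply: derivable_within_continuous => x; rewrite in_itv/= => /dg dgx.
  exact: ex_derive.
by exists c => //; move: cab; rewrite in_itv.
Qed.

Lemma is_derive_ge0_le g g1 (a b : R) : a <= b ->
  (forall x : R, a <= x <= b -> is_derive x 1 g (g1 x)) ->
  (forall x : R, a <= x <= b -> 0 <= g1 x) -> g a <= g b.
Proof.
move=> ab dg g10; have [c /g10 c0 E] := is_derive_MVT ab dg.
by rewrite -subr_ge0 E mulr_ge0// subr_ge0.
Qed.

(** Near 0 on the right, g2 x - g2 0 is at least c x, and this is integrated twice. The slack
    [c < k] lets differentiability of [g2] at the single point 0 suffice. *)
Lemma third_order_lower_bound g g1 g2 (k c : R) :
  (forall x : R, -1 < x < 1 -> is_derive x 1 g (g1 x)) ->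
  (forall x : R, -1 < x < 1 -> is_derive x 1 g1 (g2 x)) ->
  is_derive (0 : R) 1 g2 k -> c < k ->
  \forall s \near (0 : R)^'+,
    g2 0 / 2 * s ^+ 2 + c / 6 * s ^+ 3 <= g s - g 0 - g1 0 * s.
Proof.
move=> dg dg1 dg2 ck.
have : \forall s \near (0 : R)^'+, c <= (g2 (0 + s) - g2 0) / s.
  have := cvg_dnbhs_at_right (is_derive_cvg_dnbhs dg2).
  by move=> /cvgr_ge; exact.
move=> [d /= d0 hd]; near=> s.
have s0 : 0 < s by near: s; exact: nbhs_right_gt.
have s1 : s < 1 by near: s; exact: nbhs_right_lt.
have sd : s < d by near: s; exact: nbhs_right_lt.
have g2c (x : R) : 0 <= x <= s -> 0 <= g2 x - g2 0 - c * x.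
  move=> /andP[]; rewrite le_eqVlt => /predU1P[<- _|x0 xs].
    by rewrite subrr mulr0 subr0.
  have /= := hd x; rewrite sub0r normrN gtr0_norm// add0r.
  move=> /(_ (le_lt_trans xs sd) x0).
  by rewrite ler_pdivlMr// subr_ge0.
have g1c (x : R) : 0 <= x <= s -> 0 <= g1 x - g1 0 - g2 0 * x - c / 2 * x ^+ 2.
  move=> /andP[x0 xs].
  have := @is_derive_ge0_le (fun y => g1 y - g1 0 - g2 0 * y - c / 2 * y ^+ 2)
    (fun y => g2 y - g2 0 - c * y) 0 x x0.
  rewrite expr0n !mulr0 !subr0 subrr; apply.
    move=> y /andP[y0 yx]; have dg1y := dg1 y ltac:(apply/andP; split; lra).
    by apply: is_derive_eq; rewrite /GRing.scale /=; field.
  by move=> y /andP[y0 yx]; apply: g2c; rewrite y0 (le_trans yx).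
rewrite -subr_ge0.
have := @is_derive_ge0_le
  (fun y => g y - g 0 - g1 0 * y - (g2 0 / 2 * y ^+ 2 + c / 6 * y ^+ 3))
  (fun y => g1 y - g1 0 - g2 0 * y - c / 2 * y ^+ 2) 0 s (ltW s0).
rewrite !expr0n !mulr0 addr0 !subr0 subrr; apply => //.
move=> y /andP[y0 yx]; have dgy := dg y ltac:(apply/andP; split; lra).
by apply: is_derive_eq; rewrite /GRing.scale /=; field.
Unshelve. all: by end_near. Qed.

Lemma operator_convex_third_derivative g g1 g2 (k : R) :
  operator_convex (-1) 1 g ->
  (forall x : R, -1 < x < 1 -> is_derive x 1 g (g1 x)) ->
  (forall x : R, -1 < x < 1 -> is_derive x 1 g1 (g2 x)) ->
  is_derive (0 : R) 1 g2 k ->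
  0 <= g2 0 /\ k <= 3 * g2 0.
Proof.
move=> og dg dg1 dg2.
have dg10 : is_derive (0 : R) 1 g1 (g2 0) by apply: dg1; lra.
have K0 : 0 <= g2 0.
  (* For [th = 0] only the entry k / 2 of the quadratic form survives; the node 1/2 is arbitrary. *)
  have := @operator_convex_kraus R g g1 (g2 0) (1 / 2) 0 og dg dg10 ltac:(lra).
  by rewrite mulr0 expr0n !mul0r => h; lra.
split => //.
have main (c t : R) : 0 < t < 1 -> c < k -> c * t <= 3 * g2 0.
  move=> t01 ck; have /andP[t0 t1] := t01.
  (* Its derivative at [x] is [x ^- 2] times the quantity in
     [operator_convex_kraus] for [th = 1 - x / t]. *)
  pose Phi (s : R) := (1 - s / t) ^+ 2 * (g s - g 0 - g1 0 * s) * (s ^- 3)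
                      - g2 0 / 2 * s^-1.
  (* [Phi] is nondecreasing up to [t], where its first term vanishes. *)
  have PhiE (s : R) : 0 < s <= t -> Phi s <= - (g2 0 / 2) / t.
    move=> /andP[s0 st].
    have -> : - (g2 0 / 2) / t = Phi t.
      by rewrite /Phi divff ?gt_eqF// subrr; field; rewrite gt_eqF.
    apply: (@is_derive_ge0_le Phi (fun x =>
       (g2 0 / 2 - 2 * (1 - x / t) * ((g x - g 0 - g1 0 * x) / x ^+ 2)
       + (1 - x / t) ^+ 2 * ((g1 x - (g x - g 0) / x) / x)) / x ^+ 2) s t st).
      move=> x /andP[sx xt].
      have xn0 : x != 0 by rewrite gt_eqF// (lt_le_trans s0).
      have x3n0 : x ^+ 3 != 0 by rewrite expf_neq0.
      have dgx := dg x ltac:(apply/andP; split; lra).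
      have dV : is_derive x 1 (fun y : R => y^-1) (- x ^- 2).
        have := @is_deriveV R id x 1 1 xn0 (is_derive_id _ _).
        by rewrite /GRing.scale /= mulr1.
      have dV3 : is_derive x 1 (fun y : R => y ^- 3) (- 3 * x ^- 4).
        have dx3 : is_derive x 1 (fun y : R => y ^+ 3) (3 * x ^+ 2).
          apply: is_derive_eq.
          by rewrite /GRing.scale /=; ring.
        have := @is_deriveV R (fun y => y ^+ 3) x _ 1 x3n0 dx3.
        move=> h; apply: (is_derive_eq h).
        by rewrite /GRing.scale /=; field.
      apply: is_derive_eq; rewrite /GRing.scale /=; field.
      by rewrite xn0 gt_eqF.
    move=> x /andP[sx xt].
    rewrite divr_ge0// ?sqr_ge0//.
    by apply: operator_convex_kraus og dg dg10 _; apply/andP; split; lra.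
  (* When the third-order lower bound is inserted into [Phi s], the terms in 1/s cancel, so the
     limit at 0 is finite and reads c / 6 <= g2 0 / (2 t). *)
  have H : \forall s \near (0 : R)^'+,
      g2 0 / 2 * (s / t ^+ 2) + (1 - s / t) ^+ 2 * (c / 6) <= g2 0 / 2 / t.
    near=> s.
    have s0 : 0 < s by near: s; exact: nbhs_right_gt.
    have st : s < t by near: s; exact: nbhs_right_lt.
    have lb : g2 0 / 2 * s ^+ 2 + c / 6 * s ^+ 3 <= g s - g 0 - g1 0 * s.
      near: s; exact: third_order_lower_bound dg dg1 dg2 ck.
    have := PhiE s; rewrite s0 ltW// => /(_ isT) Ps.
    have := ler_wpM2l (sqr_ge0 (1 - s / t)) lb.
    have s3 : 0 <= s ^- 3 by rewrite invr_ge0 exprn_ge0// ltW.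
    move=> /(ler_wpM2r s3); rewrite -(lerD2r (- (g2 0 / 2 * s^-1))).
    move=> /le_trans/(_ Ps); rewrite -subr_ge0 -[in X in _ -> X]subr_ge0.
    congr (0 <= _); field.
    by rewrite !gt_eqF.
  have L : g2 0 / 2 * (s / t ^+ 2) + (1 - s / t) ^+ 2 * (c / 6)
      @[s --> (0 : R)^'+] -->
      g2 0 / 2 * (0 / t ^+ 2) + (1 - 0 / t) ^+ 2 * (c / 6).
    have ec : s @[s --> (0:R)^'+] --> (0:R).
      by apply: cvg_at_right_filter; exact: cvg_id.
    have cc (a : R) : a @[_ --> (0:R)^'+] --> a by exact: cvg_cst.
    have sc : 1 - s / t @[s --> (0:R)^'+] --> 1 - 0 / t.
      by apply: cvgB => //; exact: cvgM.
    apply: cvgD; first by apply: cvgM => //; exact: cvgM.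
    by apply: cvgM => //; exact: cvgM.
  have := cvgr_to_le L H.
  rewrite !mul0r mulr0 add0r subr0 expr1n mul1r ler_pdivlMr// => h.
  have {}h := h (at_right_proper_filter _); lra.
rewrite leNgt; apply/negP => kK.
(* If k > 3 g2 0, this [c] lies strictly between the two; the value of [t] used below is chosen so
   that c t is the midpoint of 3 g2 0 and c, which contradicts [main]. *)
pose c := (k + 3 * g2 0) / 2.
have c0 : 0 < c by rewrite /c; lra.
have := main c ((3 * g2 0 + c) / (2 * c)).
have -> : c * ((3 * g2 0 + c) / (2 * c)) = (3 * g2 0 + c) / 2.
  by field; rewrite gt_eqF.
have c3 : 3 * g2 0 < c by rewrite /c; lra.
have -> : 0 < (3 * g2 0 + c) / (2 * c) < 1.
  by rewrite divr_gt0 ?ltr_pdivrMr ?mulr_gt0//; lra.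
have ck : c < k by rewrite /c; lra.
by move=> /(_ isT ck) h; lra.
Unshelve. all: by end_near. Qed.

End ThirdDerivative.

(** * Functions of class C^k *)

Section Ck.
Variable R : realType.

Lemma is_derive_line (V : normedModType R) (f : V -> R) (x h : V) (t : R) :
  derivable f (x + t *: h) h ->
  is_derive t 1 (fun s => f (x + s *: h)) ('D_h f (x + t *: h)).
Proof.
move=> df.
have E : (fun e : R => e^-1 *: (f (x + (e *: 1 + t) *: h) - f (x + t *: h))) =
   (fun e => e^-1 *: (f (e *: h + (x + t *: h)) - f (x + t *: h))).
  by apply/funext => e; rewrite scalerDl [e *: 1]mulr1 addrCA.
by split; rewrite /derivable /derive /= E.
Qed.

Section Ck_rules.
Variables (V : normedModType R) (D : set V).
Hypothesis oD : open D.
Implicit Types (f g : V -> R) (k : nat).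

Lemma open_near (x : V) : D x -> \forall y \near x, D y.
Proof. by move=> Dx; exact: open_nbhs_nbhs. Qed.

(** Both functions have the same first-order expansion at [x], and uniqueness of the differential
    identifies the two linear maps. *)
Lemma near_eq_differentiable f g x : {near x, f =1 g} ->
  differentiable f x -> differentiable g x.
Proof.
move=> fg df; have fgx : f x = g x by exact: nbhs_singleton fg.
have E : g \o shift x = cst (g x) + 'd f x +o_ 0 id.
  apply/eqaddoP => e e0; have /eqaddoP/(_ e e0) := diff_locally df.
  have fg0 : \forall y \near (0 : V), f (y + x) = g (y + x).
    by move: fg; rewrite (near_shift 0) subr0 => fg; near=> y; near: y.
  move=> fe; near=> y.
  have : `|(f \o shift x - (cst (f x) + 'd f x)) y| <= e * `|id y| by near: y.
  by rewrite !fctE /= fgx (_ : f (y + x) = g (y + x))//; near: y.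
apply/diff_locallyP; have dE := diff_unique (diff_continuous df) E.
by rewrite dE; split => //; exact: diff_continuous.
Unshelve. all: by end_near. Qed.

(** [D] is open, so equality on [D] is equality of germs at its points. This allows a derivative to
    be replaced by a formula that holds only on [D]. *)
Lemma Ck_ext k f g : (forall x, D x -> f x = g x) -> Ck k D f -> Ck k D g.
Proof.
elim: k f g => [|k IH] f g fg.
  move=> fc x Dx.
  rewrite /prop_for /continuous_at -fg//; apply: cvg_trans (fc x Dx).
  by apply: near_eq_cvg; near=> y; apply: fg; near: y; exact: open_near.
move=> [df dfk]; split => [x Dx|h].
  apply: (@near_eq_differentiable f); last exact: df.
  by near=> y; apply: fg; near: y; exact: open_near.
apply: IH (dfk h) => x Dx; apply: near_eq_derive.
by near=> y; apply: fg; near: y; exact: open_near.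
Unshelve. all: by end_near. Qed.

Lemma Ck_differentiable k f x : Ck k.+1 D f -> D x -> differentiable f x.
Proof. by move=> [df _]; exact: df. Qed.

Lemma Ck_derive k f h : Ck k.+1 D f -> Ck k D ('D_h f).
Proof. by move=> [_]; exact. Qed.

Lemma CkS k f : Ck k.+1 D f -> Ck k D f.
Proof.
elim: k f => [|k IH] f [df dfk].
  by move=> x Dx; exact/differentiable_continuous/df.
by split => // h; exact/IH/dfk.
Qed.

Lemma Ck_cst k (c : R) : Ck k D (fun=> c).
Proof.
elim: k c => [|k IH] c; first by move=> x _; exact: cst_continuous.
split=> [x _|h]; first exact: differentiable_cst.
by apply: (@Ck_ext _ (fun=> 0)) => // x _; rewrite derive_cst.
Qed.

Lemma CkD k f g : Ck k D f -> Ck k D g -> Ck k D (fun x => f x + g x).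
Proof.
elim: k f g => [|k IH] f g.
  by move=> fc gc x Dx; apply: cvgD; [exact: fc|exact: gc].
move=> [df dfk] [dg dgk]; split=> [x Dx|h].
  by apply: differentiableD; [exact: df|exact: dg].
apply: Ck_ext (IH _ _ (dfk h) (dgk h)) => x Dx.
by rewrite -deriveD//; apply: diff_derivable; [exact: df|exact: dg].
Qed.

Lemma CkN k f : Ck k D f -> Ck k D (fun x => - f x).
Proof.
elim: k f => [|k IH] f; first by move=> fc x Dx; apply: cvgN; exact: fc.
move=> [df dfk]; split=> [x Dx|h]; first by apply: differentiableN; exact: df.
apply: Ck_ext (IH _ (dfk h)) => x Dx.
by rewrite -deriveN//; apply: diff_derivable; exact: df.
Qed.

Lemma CkM k f g : Ck k D f -> Ck k D g -> Ck k D (fun x => f x * g x).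
Proof.
elim: k f g => [|k IH] f g.
  by move=> fc gc x Dx; apply: cvgM; [exact: fc|exact: gc].
move=> fk gk; have [[df dfk] [dg dgk]] := (fk, gk); split=> [x Dx|h].
  by apply: differentiableM; [exact: df|exact: dg].
apply: Ck_ext (CkD (IH _ _ (CkS fk) (dgk h)) (IH _ _ (CkS gk) (dfk h))) => x Dx.
by rewrite -deriveM//; apply: diff_derivable; [exact: df|exact: dg].
Qed.

(** The derivative of 1/f is a product of 1/f, 1/f and a derivative of f, all of class one lower, so
    the induction closes. *)
Lemma CkV k f : (forall x, D x -> f x != 0) -> Ck k D f ->
  Ck k D (fun x => (f x)^-1).
Proof.
move=> f0; elim: k => [|k IH].
  by move=> fc x Dx; apply: cvgV; [exact: f0|exact: fc].
move=> fk; have [df dfk] := fk; split=> [x Dx|h].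
  by apply: differentiableV; [exact: df|exact: f0].
have fVk := IH (CkS fk).
apply: Ck_ext (CkN (CkM (CkM fVk fVk) (dfk h))) => x Dx.
rewrite deriveV ?f0//; last exact/diff_derivable/df.
by rewrite expr2 invfM scaleNr.
Qed.

Lemma differentiable_ln f x : 0 < f x -> differentiable f x ->
  differentiable (fun y => ln (f y)) x.
Proof.
move=> fx0 df; apply: (@differentiable_comp _ _ _ _ f (@ln R)) => //.
by apply/derivable1_diffP; apply: ex_derive; exact: is_derive1_ln.
Qed.

Lemma is_derive_ln f x h : 0 < f x -> differentiable f x ->
  is_derive x h (fun y => ln (f y)) ('D_h f x / f x).
Proof.
move=> fx0 df; have dlf := differentiable_ln fx0 df.
apply: DeriveDef; first exact: diff_derivable.
have dl : is_derive (f x) 1 (@ln R) (f x)^-1 by exact: is_derive1_ln.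
have dlx : differentiable (@ln R) (f x).
  by apply/derivable1_diffP; apply: ex_derive.
rewrite deriveE// (@diff_comp _ _ _ _ f (@ln R))//= diff1E//= -deriveE//.
by rewrite /= derive1E derive_val.
Qed.

(** The derivative f'/f no longer contains a logarithm, so a case distinction replaces the
    induction. *)
Lemma Ck_ln k f : (forall x, D x -> 0 < f x) -> Ck k D f ->
  Ck k D (fun x => ln (f x)).
Proof.
move=> f0; case: k => [|k].
  move=> fc x Dx; apply: (@continuous_comp _ _ _ f (@ln R)); first exact: fc.
  exact/continuous_ln/f0.
move=> fk; have [df dfk] := fk; split=> [x Dx|h].
  by apply: differentiable_ln; [exact: f0|exact: df].
have fVk : Ck k D (fun x => (f x)^-1).
  by apply: CkV (CkS fk) => x /f0; exact: lt0r_neq0.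
apply: Ck_ext (CkM (dfk h) fVk) => x Dx.
by rewrite (@derive_val _ _ _ _ _ _ _ (is_derive_ln h (f0 _ Dx) (df _ Dx))).
Qed.

End Ck_rules.

Lemma Ck_sub (V : normedModType R) (D E : set V) k (f : V -> R) :
  D `<=` E -> Ck k E f -> Ck k D f.
Proof.
move=> DE; elim: k f => [|k IH] f; first by move=> fc x /DE; exact: fc.
by move=> [df dfk]; split=> [x /DE|h]; [exact: df|exact/IH/dfk].
Qed.

(** * Projections of a product space *)

Section product.
Variables U V : normedModType R.

Lemma differentiable_fst (p : U * V) : differentiable (@fst U V) p.
Proof. by apply: linear_differentiable => q; exact: cvg_fst. Qed.

Lemma differentiable_snd (p : U * V) : differentiable (@snd U V) p.
Proof. by apply: linear_differentiable => q; exact: cvg_snd. Qed.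

Lemma is_derive_comp_snd (f : V -> R) (p h : U * V) : derivable f p.2 h.2 ->
  is_derive p h (fun q => f q.2) ('D_(h.2) f p.2).
Proof. by move=> df; split. Qed.

Lemma is_derive_fst (p h : U * V) : is_derive p h (@fst U V) h.1.
Proof.
have df := differentiable_fst p; apply: DeriveDef; first exact: diff_derivable.
by rewrite deriveE// diff_lin//= => q; exact: cvg_fst.
Qed.

Lemma Ck_comp_snd k (D : set V) (f : V -> R) : open D -> Ck k D f ->
  Ck k [set p : U * V | D p.2] (fun p => f p.2).
Proof.
move=> oD; have oD2 : open [set p : U * V | D p.2].
  by apply: open_comp oD => p _; exact: cvg_snd.
elim: k f => [|k IH] f.
  move=> fc p /= Dp; apply: (@continuous_comp _ _ _ (@snd U V) f).
    exact: cvg_snd.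
  exact: fc.
move=> [df dfk]; split=> [p Dp|h].
  apply: (@differentiable_comp _ _ _ _ (@snd U V) f).
    exact: differentiable_snd.
  exact: df.
by apply: Ck_ext (IH _ (dfk h.2)).
Qed.

End product.

Lemma Ck_fst (V : normedModType R) k (D : set (R * V)) : open D ->
  Ck k D (@fst R V).
Proof.
move=> oD; case: k => [|k]; first by move=> p _; exact: cvg_fst.
split=> [p _|h]; first exact: differentiable_fst.
apply: Ck_ext (@Ck_cst _ D oD k h.1) => // p _.
by rewrite (@derive_val _ _ _ _ _ _ _ (is_derive_fst p h)).
Qed.

End Ck.

(** * Self-concordant functions *)

Section SelfConcordantOneVariable.
Variable R : realType.

Lemma powR32 (a : R) : 0 <= a -> a `^ (3 / 2) = a * Num.sqrt a.
Proof.
move=> a0; have -> : 3 / 2 = 1 + 2^-1 :> R by field.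
rewrite powRD; first by rewrite powRr1// powR12_sqrt.
by apply/implyP => /eqP h; exfalso; lra.
Qed.

(* The function [(g + e)^(-1/2)] is 1-Lipschitz. *)
Lemma sc_hessian_bound (g g1 : R -> R) (e s : R) :
  0 <= s <= 1 -> 0 < e -> g 0 + e < 1 ->
  (forall x : R, 0 <= x <= s -> is_derive x 1 g (g1 x)) ->
  (forall x : R, 0 <= x <= s -> 0 <= g x) ->
  (forall x : R, 0 <= x <= s -> `|g1 x| <= 2 * g x `^ (3 / 2)) ->
  g s <= ((Num.sqrt (g 0 + e))^-1 - 1) ^- 2.
Proof.
move=> /andP[s0 s1] e0 ge1 dg g0 g1le.
(* The term [e] keeps the argument positive, where the square root is differentiable; [g] itself may
   vanish. *)
pose w (x : R) := Num.sqrt (g x + e).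
have gp (x : R) : 0 <= x <= s -> 0 < g x + e by move=> /g0 gx; rewrite ltr_wpDl.
have wp (x : R) : 0 <= x <= s -> 0 < w x by move=> /gp gx; rewrite sqrtr_gt0.
have w2 (x : R) : 0 <= x <= s -> w x ^+ 2 = g x + e.
  by move=> /gp gx; rewrite sqr_sqrtr// ltW.
have dw (x : R) : 0 <= x <= s ->
    is_derive x 1 (fun y => (w y)^-1) (- (w x) ^- 2 * (g1 x / (2 * w x))).
  move=> xs; have dgx := dg x xs; have gx := gp x xs.
  have ds : is_derive (g x + e) 1 (@Num.sqrt R) (2 * w x)^-1.
    exact: is_derive1_sqrt.
  have dge : is_derive x 1 (fun y => g y + e) (g1 x).
    by apply: is_derive_eq; rewrite addr0.
  have dwx := @is_derive1_comp R (@Num.sqrt R) (fun y => g y + e) x _ _ ds dge.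
  have := @is_deriveV R w x _ 1 (lt0r_neq0 (wp x xs)) dwx.
  by move=> h; apply: (is_derive_eq h); rewrite /GRing.scale /= [g1 x / _]mulrC.
have dw1 (x : R) : 0 <= x <= s -> -1 <= - (w x) ^- 2 * (g1 x / (2 * w x)).
  move=> xs; have wx := wp x xs.
  have : `|g1 x| <= 2 * (w x ^+ 2 * w x).
    apply: le_trans (g1le x xs) _; rewrite ler_pM2l// powR32 ?g0//.
    apply: ler_pM; rewrite ?g0//.
      by rewrite w2// lerDl ltW.
    by rewrite /w ler_sqrt ?lerDl ?ltW ?gp.
  move=> /(le_trans (ler_norm _)) h; rewrite mulNr lerN2.
  have -> : w x ^- 2 * (g1 x / (2 * w x)) = g1 x / (2 * (w x ^+ 2 * w x)).
    by field; rewrite lt0r_neq0.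
  by rewrite ler_pdivrMr ?mul1r// !mulr_gt0.
have [c cs E] := is_derive_MVT s0 dw.
have h : (w 0)^-1 - 1 <= (w s)^-1.
  have := ler_wpM2r s0 (dw1 c cs); rewrite subr0 in E; rewrite -E => h.
  by lra.
have w01 : w 0 < 1.
  rewrite -[ltRHS]sqrtr1 /w ltr_sqrt ?ltr01//.
have ws0 : 0 <= s <= s by rewrite s0 lexx.
have h0 : 0 < (w 0)^-1 - 1.
  by rewrite subr_gt0 invf_gt1// wp// lexx s0.
rewrite -/(w 0).
apply: (@le_trans _ _ (w s ^+ 2)); first by rewrite w2// lerDl ltW.
rewrite -[leLHS]invrK lef_pV2 ?posrE ?exprn_gt0 ?invr_gt0 ?exprn_gt0 ?wp//.
by rewrite -exprVn lerXn2r// nnegrE ?ltW// invr_gt0 wp.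
Qed.

(** The bound on the second derivative is integrated twice over an interval of length at most 1. The
    result depends only on data at 0, hence is uniform in [s]. *)
Lemma sc_value_bound (g g1 g2 g3 : R -> R) (s : R) :
  0 <= s <= 1 -> g2 0 < 1 ->
  (forall x : R, 0 <= x <= s -> is_derive x 1 g (g1 x)) ->
  (forall x : R, 0 <= x <= s -> is_derive x 1 g1 (g2 x)) ->
  (forall x : R, 0 <= x <= s -> is_derive x 1 g2 (g3 x)) ->
  (forall x : R, 0 <= x <= s -> 0 <= g2 x) ->
  (forall x : R, 0 <= x <= s -> `|g3 x| <= 2 * g2 x `^ (3 / 2)) ->
  g s <= g 0 + `|g1 0| + ((Num.sqrt ((1 + g2 0) / 2))^-1 - 1) ^- 2.
Proof.
move=> s01 g21 dg dg1 dg2 g20 g3le; have /andP[s0 s1] := s01.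
set M := _ ^- 2.
have M0 : 0 <= M by rewrite invr_ge0 sqr_ge0.
have g2M (x : R) : 0 <= x <= s -> g2 x <= M.
  move=> /andP[x0 xs].
  have sub (y : R) : 0 <= y <= x -> 0 <= y <= s.
    by move=> /andP[-> yx]; exact: le_trans xs.
  (* The regularization is e = (1 - g2 0) / 2, half the gap to 1, so that g2 0 + e stays below 1. *)
  rewrite /M (_ : (1 + g2 0) / 2 = g2 0 + (1 - g2 0) / 2); last by field.
  apply: (@sc_hessian_bound g2 g3) => //.
  - by rewrite x0 (le_trans xs).
  - by lra.
  - by lra.
  - by move=> y /sub; exact: dg2.
  - by move=> y /sub; exact: g20.
  - by move=> y /sub; exact: g3le.
have [c /andP[c0 cs] E] := is_derive_MVT s0 dg.
have subc (y : R) : 0 <= y <= c -> 0 <= y <= s.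
  by move=> /andP[-> yx]; exact: le_trans cs.
have [d /subc/g2M dM E1] := is_derive_MVT c0 (fun x xc => dg1 x (subc x xc)).
have g1c : g1 c <= `|g1 0| + M.
  have -> : g1 c = g1 0 + g2 d * (c - 0) by rewrite -E1; ring.
  rewrite lerD ?ler_norm// subr0.
  apply: (@le_trans _ _ (M * c)); first exact: ler_wpM2r.
  by rewrite ler_piMr// (le_trans cs).
have -> : g s = g 0 + g1 c * s by rewrite subr0 in E; rewrite -E; ring.
rewrite -addrA lerD2l.
apply: (@le_trans _ _ ((`|g1 0| + M) * s)); first exact: ler_wpM2r.
by rewrite ler_piMr// addr_ge0.
Qed.

End SelfConcordantOneVariable.

(** * Homogeneity in the direction and restriction to lines *)

Section Directions.
Variables (R : realType) (V : normedModType R) (D : set V).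
Hypothesis oD : open D.
Implicit Types f : V -> R.

Lemma derive_dirZ f x (r : R) h : differentiable f x ->
  'D_(r *: h) f x = r * 'D_h f x.
Proof. by move=> df; rewrite !deriveE// linearZ. Qed.

Lemma derive2_dirZ f x (r : R) h : Ck 2 D f -> D x ->
  'D_(r *: h) ('D_(r *: h) f) x = r ^+ 2 * 'D_h ('D_h f) x.
Proof.
move=> fk Dx.
have df y : D y -> differentiable f y by exact: Ck_differentiable fk.
have dfh := Ck_derive h fk.
have ddf : differentiable ('D_h f) x by exact: Ck_differentiable dfh Dx.
transitivity ('D_(r *: h) (fun y => r * 'D_h f y) x).
  apply: near_eq_derive.
  by near=> y; rewrite derive_dirZ//; apply: df; near: y; exact: open_near.
rewrite deriveMl; last exact: diff_derivable.
by rewrite derive_dirZ// mulrA.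
Unshelve. all: by end_near. Qed.

Lemma derive3_dirZ f x (r : R) h : Ck 3 D f -> D x ->
  'D_(r *: h) ('D_(r *: h) ('D_(r *: h) f)) x =
  r ^+ 3 * 'D_h ('D_h ('D_h f)) x.
Proof.
move=> fk Dx; have fk2 := CkS fk.
have ddf : differentiable ('D_h ('D_h f)) x.
  by apply: Ck_differentiable Dx; exact/Ck_derive/Ck_derive/fk.
transitivity ('D_(r *: h) (fun y => r ^+ 2 * 'D_h ('D_h f) y) x).
  apply: near_eq_derive.
  by near=> y; rewrite derive2_dirZ//; near: y; exact: open_near.
rewrite deriveMl; last exact: diff_derivable.
by rewrite derive_dirZ// mulrA -exprSr.
Unshelve. all: by end_near. Qed.

Section Line.
Variables (f : V -> R) (x h : V) (t : R).
Hypothesis Dt : D (x + t *: h).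

Lemma is_derive_line1 : Ck 1 D f ->
  is_derive t 1 (fun s => f (x + s *: h)) ('D_h f (x + t *: h)).
Proof.
move=> fk; apply: is_derive_line.
exact/diff_derivable/(Ck_differentiable fk).
Qed.

Lemma is_derive_line2 : Ck 2 D f ->
  is_derive t 1 (fun s => 'D_h f (x + s *: h)) ('D_h ('D_h f) (x + t *: h)).
Proof.
move=> /(Ck_derive h) fk.
by apply: is_derive_line; exact/diff_derivable/(Ck_differentiable fk).
Qed.

Lemma is_derive_line3 : Ck 3 D f ->
  is_derive t 1 (fun s => 'D_h ('D_h f) (x + s *: h))
    ('D_h ('D_h ('D_h f)) (x + t *: h)).
Proof.
move=> /(Ck_derive h)/(Ck_derive h) fk.
by apply: is_derive_line; exact/diff_derivable/(Ck_differentiable fk).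
Qed.

End Line.

Lemma line_cvg (x h : V) (t : R) : (fun s : R => x + s *: h) @ t --> x + t *: h.
Proof. by apply: cvgD; [exact: cvg_cst|apply: cvgZr_tmp; exact: cvg_id]. Qed.

Lemma line_nbhs (x h : V) : D x ->
  exists2 r : R, 0 < r & forall s, `|s| < r -> D (x + s *: h).
Proof.
move=> Dx; have := @line_cvg x h 0; rewrite scale0r addr0 => /(_ D).
move=> /(_ (open_near oD Dx)) /= [r /= r0 hr]; exists r => // s sr.
by apply: hr; rewrite /= sub0r normrN.
Qed.

End Directions.

(** * Convexity of the domain, sign of the Hessian, Dikin's theorem *)

Section SelfConcordant.
Variables (R : realType) (V : normedModType R) (G : V -> \bar R).
Hypothesis scG : self_concordant G.
Local Notation E := (edom G).
Local Notation g := (fine \o G).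

Lemma edomE x : E x -> G x = (g x)%:E.
Proof.
move=> Ex; rewrite /= fineK// fin_numE sc_proper//=.
by move: Ex; rewrite /edom /= ltey.
Qed.

Lemma sc_strict_convex x y (l : R) : E x -> E y -> x != y -> 0 < l < 1 ->
  E (l *: x + (1 - l) *: y) /\
  g (l *: x + (1 - l) *: y) < l * g x + (1 - l) * g y.
Proof.
move=> Ex Ey xy l01; have := sc_strictly_convex scG Ex Ey xy l01.
rewrite (edomE Ex) (edomE Ey) -!EFinM -EFinD => h.
have Ez : E (l *: x + (1 - l) *: y) by apply: lt_trans h _; rewrite ltry.
by split => //; move: h; rewrite (edomE Ez) lte_fin.
Qed.

Lemma sc_convex_dom x y (l : R) : E x -> E y -> 0 <= l <= 1 ->
  E (l *: x + (1 - l) *: y).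
Proof.
move=> Ex Ey /andP[]; rewrite !le_eqVlt => /predU1P[<-|l0].
  by rewrite scale0r subr0 scale1r add0r.
move=> /predU1P[->|l1]; first by rewrite subrr scale0r scale1r addr0.
have [->|xy] := eqVneq x y; first by rewrite -scalerDl addrC subrK scale1r.
by have [] := @sc_strict_convex x y l Ex Ey xy; rewrite ?l0.
Qed.

(** The second derivative is a limit of symmetric second differences, which convexity makes
    nonnegative. The case [h = 0] is separate because strict convexity compares distinct points. *)
Lemma sc_hessian_ge0 x h : E x -> 0 <= 'D_h ('D_h g) x.
Proof.
move=> Ex; have [->|h0] := eqVneq h 0; first by rewrite derive0.
have [r r0 hr] := line_nbhs (sc_open_dom scG) h Ex.
have gk := sc_C3 scG.
have dg (t : R) : - r < t < r ->
    is_derive t 1 (fun s => g (x + s *: h)) ('D_h g (x + t *: h)).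
  move=> tr; apply: is_derive_line1 (CkS (CkS gk)).
  by apply: hr; rewrite ltr_norml.
have Ex0 : E (x + 0 *: h) by rewrite scale0r addr0.
have := second_difference r0 dg (is_derive_line2 Ex0 (CkS gk)).
rewrite scale0r addr0 => /cvgr_to_ge; apply.
near=> e.
have e0 : 0 < e by near: e; exact: nbhs_right_gt.
have er : e < r by near: e; exact: nbhs_right_lt.
rewrite divr_ge0 ?exprn_ge0 ?(ltW e0)//.
have Ep : E (x + e *: h) by apply: hr; rewrite gtr0_norm.
have Em : E (x + (- e) *: h) by apply: hr; rewrite normrN gtr0_norm.
have half : 0 < (2^-1 : R) < 1 by rewrite invr_gt0 ltr0n invf_lt1// ltr1n.
have ne : x + e *: h != x + (- e) *: h.
  apply/negP => /eqP /addrI /eqP; rewrite scaleNr -addr_eq0 -mulr2n -scaler_nat.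
  by rewrite !scaler_eq0 pnatr_eq0 (gt_eqF e0) (negbTE h0).
have [_] := sc_strict_convex Ep Em ne half.
have -> : 2^-1 *: (x + e *: h) + (1 - 2^-1) *: (x + - e *: h) = x.
  have -> : 1 - 2^-1 = 2^-1 :> R by field.
  rewrite -scalerDr scaleNr addrACA subrr addr0 -[x + x]mulr2n.
  rewrite -[x *+ 2]scaler_nat scalerA.
  by rewrite mulVf ?pnatr_eq0// scale1r.
by rewrite /= => hh; lra.
Unshelve. all: by end_near. Qed.

(** Along the segment to x + h the values of [g] stay below a fixed [N]. The closed epigraph then
    keeps the last point reached inside the domain, and openness of the domain continues past it. *)
Lemma sc_dikin x h : E x -> 'D_h ('D_h g) x < 1 -> E (x + h).
Proof.
move=> Ex q1; have gk := sc_C3 scG.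
pose S := [set s : R | 0 <= s <= 1 /\ E (x + s *: h)].
pose N := g x + `|'D_h g x|
  + ((Num.sqrt ((1 + 'D_h ('D_h g) x) / 2))^-1 - 1) ^- 2.
have S0 : S 0 by split; rewrite ?lexx ?ler01// scale0r addr0.
have SN s : S s -> g (x + s *: h) <= N.
  move=> [s01 Es]; have /andP[s0 s1] := s01.
  have Eu u : 0 <= u <= s -> E (x + u *: h).
    move=> /andP[]; rewrite le_eqVlt => /predU1P[<- _|u0 us].
      by rewrite scale0r addr0.
    have sp : 0 < s by exact: lt_le_trans us.
    have -> : x + u *: h = (u / s) *: (x + s *: h) + (1 - u / s) *: x.
      rewrite scalerDr scalerA divfK ?gt_eqF// addrAC -scalerDl.
      by rewrite [u / s + _]addrC subrK scale1r.
    apply: sc_convex_dom => //; apply/andP; split.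
      by rewrite divr_ge0 ?ltW.
    by rewrite ler_pdivrMr// mul1r.
  have := @sc_value_bound R (fun u => g (x + u *: h))
    (fun u => 'D_h g (x + u *: h)) (fun u => 'D_h ('D_h g) (x + u *: h))
    (fun u => 'D_h ('D_h ('D_h g)) (x + u *: h)) s s01.
  rewrite scale0r addr0 -/N => /(_ q1); apply.
  - by move=> u /Eu Exu; exact: is_derive_line1 Exu (CkS (CkS gk)).
  - by move=> u /Eu Exu; exact: is_derive_line2 Exu (CkS gk).
  - by move=> u /Eu Exu; exact: is_derive_line3 Exu gk.
  - by move=> u /Eu Exu; exact: sc_hessian_ge0.
  - by move=> u /Eu Exu; exact: (sc_ineq scG).
have supS : has_sup S.
  by split; [exists 0|exists 1 => s [/andP[]]].
pose b := sup S.
have b1 : b <= 1 by apply: ge_sup => [|s [/andP[]]//]; exists 0.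
have b0 : 0 <= b by exact: ub_le_sup (supS.2) _ S0.
have Sb s : 0 <= s -> s < b -> S s.
  move=> s0 sb; have [t St st] := @sup_adherent R S (b - s) ltac:(lra) supS.
  have {}st : s < t by move: st; rewrite -/b; lra.
  have [/andP[t0 t1] Et] := St; split; first by rewrite s0; lra.
  have tp : 0 < t by lra.
  have -> : x + s *: h = (s / t) *: (x + t *: h) + (1 - s / t) *: x.
    rewrite scalerDr scalerA divfK ?gt_eqF// addrAC -scalerDl.
    by rewrite [s / t + _]addrC subrK scale1r.
  apply: sc_convex_dom => //; apply/andP; split.
    by rewrite divr_ge0// ltW.
  by rewrite ler_pdivrMr// mul1r ltW.
have Eb : E (x + b *: h).
  move: b0; rewrite le_eqVlt => /predU1P[<-|bp]; first by rewrite scale0r addr0.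
  (* The points (N, x + s h) with s < b lie in the epigraph; closedness gives the limit s = b, hence
     a finite value there. *)
  have : epi G (N, x + b *: h).
    apply: (@closed_cvg _ _ (b^'-) _ (fun s : R => (N, x + s *: h)) _
      (sc_closed scG)).
      near=> s.
      have s0 : 0 <= s by near: s; exact: nbhs_left_ge.
      have sb : s < b by near: s; exact: nbhs_left_lt.
      have Ss := Sb s s0 sb.
      by rewrite /epi /= (edomE Ss.2) lee_fin; exact: SN.
    apply: (@cvg_pair _ _ _ (b^'-) (nbhs N) (nbhs (x + b *: h)) _ _ _
      (fun=> N) (fun s => x + s *: h)); first exact: cvg_cst.
    by apply: cvg_at_left_filter; exact: line_cvg.
  by rewrite /epi /= => h1; apply: le_lt_trans h1 _; rewrite ltry.
move: b1; rewrite le_eqVlt => /predU1P[b1|b1].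
  by move: Eb; rewrite b1 scale1r.
have [r r0 hr] := line_nbhs (sc_open_dom scG) h Eb.
(* A step that stays both in the ball around x + b h and below the parameter 1 contradicts the
   choice of [b] as a supremum. *)
pose e := Num.min (r / 2) (1 - b).
have e0 : 0 < e by rewrite lt_min; apply/andP; split; lra.
have er : e < r by rewrite /e gt_min; apply/orP; left; lra.
have eb : e <= 1 - b by rewrite /e ge_min lexx orbT.
have : S (b + e).
  split; first by apply/andP; split; lra.
  by rewrite scalerDl addrA; apply: hr; rewrite gtr0_norm.
by move=> /(ub_le_sup supS.2); rewrite -/b; lra.
Unshelve. all: by end_near. Qed.

End SelfConcordant.

(** * Compatibility and the barrier of the epigraph *)

Section Domain.
Variables (R : realType) (V : normedModType R).
Implicit Types A B : set V.

Lemma open_ballP A (x : V) : open A -> A x ->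
  exists2 r : R, 0 < r & forall y, `|y - x| < r -> A y.
Proof.
move=> oA Ax; have /nbhs_ballP[r /= r0 hr] := open_nbhs_nbhs (conj oA Ax).
by exists r => // y yx; apply: hr; rewrite -ball_normE /= distrC.
Qed.

Lemma closure_ballP A (x : V) (r : R) : closure A x -> 0 < r ->
  exists2 y, A y & `|y - x| < r.
Proof.
move=> cA r0; have [y [Ay]] := cA _ (nbhsx_ballx x r r0).
by rewrite -ball_normE /= distrC => yx; exists y.
Qed.

(** The point [y] is the midpoint of a nearby [z] in [B] and its reflection 2 y - z, which lies in
    [A]. Approximating the reflection by [z'] in [B] and moving [z] by the opposite error keeps [y]
    the midpoint of two points of [B]. *)
Lemma open_sub_closure_convex A B : open A -> open B ->
  (forall x y, B x -> B y -> B (2^-1 *: x + (1 - 2^-1) *: y)) ->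
  A `<=` closure B -> A `<=` B.
Proof.
move=> oA oB cB AB y Ay; have [r r0 hr] := open_ballP oA Ay.
have [z Bz zy] := closure_ballP (AB _ Ay) r0.
have [s s0 hs] := open_ballP oB Bz.
have /AB/closure_ballP/(_ s0)[z' Bz' zz'] : A (y + y - z).
  by apply: hr; rewrite addrAC addrK distrC.
have Bu : B (z - (z' - (y + y - z))).
  by apply: hs; rewrite addrAC subrr add0r normrN.
have := cB _ _ Bu Bz'.
have -> : 1 - 2^-1 = 2^-1 :> R by field.
rewrite -scalerDr (_ : z - (z' - (y + y - z)) + z' = 2 *: y).
  by rewrite scalerA mulVf ?pnatr_eq0// scale1r.
by rewrite opprB addrA subrK addrC subrK scaler_nat mulr2n.
Qed.

End Domain.

(** * Compatibility of the function with the barrier, and its convexity *)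

Section Compatibility.
Variables (R : realType) (V : normedModType R) (D : set V) (f : V -> R)
  (G : V -> \bar R).
Hypotheses (oD : open D) (fk : Ck 3 D f) (scG : self_concordant G).
Hypothesis clG : closure (edom G) = closure D.
Hypothesis opf : forall x h : V,
  D x -> closure D (x + h) -> closure D (x - h) ->
  (forall t : R, -1 < t < 1 -> D (x + t *: h)) /\
  operator_convex (-1) 1 (fun t : R => f (x + t *: h)).
Local Notation g := (fine \o G).

(** Both sets are open with the same closure. One inclusion comes from convexity of [edom G]; the
    other from the segments in [D] that the hypothesis [opf] supplies, since convexity of [D] is not
    yet known. *)
Lemma edom_barrier : edom G = D.
Proof.
have oG := sc_open_dom scG.
apply/seteqP; split; last first.
  apply: (open_sub_closure_convex oD oG) => [x y Gx Gy|x Dx].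
    by apply: sc_convex_dom => //; lra.
  by rewrite clG; exact: subset_closure.
move=> y Gy; have [r r0 hr] := open_ballP oG Gy.
have : closure D y by rewrite -clG; exact: subset_closure.
have r3 : 0 < r / 3 by rewrite divr_gt0.
move=> /closure_ballP/(_ r3)[x Dx xy].
have clD z : `|z - y| < r -> closure D z.
  by move=> /hr Gz; rewrite -clG; exact: subset_closure.
(* The endpoints x + h and x - h differ from [y] by y - x and 3 (x - y), which explains the radius r
   / 3; [y] itself is reached at parameter 1/2. *)
have [] := opf (h := 2 *: (y - x)) Dx.
- apply: clD; rewrite (_ : _ - y = y - x).
    by rewrite distrC; lra.
  by rewrite scaler_nat mulr2n addrA [x + _]addrC subrK addrAC subrr add0r.
- apply: clD; rewrite (_ : _ - y = 3 *: (x - y)).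
    by rewrite normrZ ger0_norm//; lra.
  rewrite -scalerN opprB addrAC -{1}[x - y]scale1r -scalerDl.
  by congr (_ *: _); ring.
move=> /(_ 2^-1) + _.
rewrite scalerA mulVf ?pnatr_eq0// scale1r addrC subrK; apply.
by lra.
Qed.

Lemma operator_convex_direction x h : D x -> 'D_h ('D_h g) x < 1 ->
  0 <= 'D_h ('D_h f) x /\ 'D_h ('D_h ('D_h f)) x <= 3 * 'D_h ('D_h f) x.
Proof.
move=> Dx q1.
have Gx : edom G x by rewrite edom_barrier.
have gk : Ck 2 (edom G) g by exact: CkS (sc_C3 scG).
have qN : 'D_(- h) ('D_(- h) g) x < 1.
  by rewrite -scaleN1r (derive2_dirZ (sc_open_dom scG))// sqrrN expr1n mul1r.
have cl (k : V) : 'D_k ('D_k g) x < 1 -> closure D (x + k).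
  by move=> /(sc_dikin scG Gx); rewrite edom_barrier; exact: subset_closure.
have [Dl opl] := opf Dx (cl _ q1) (cl _ qN).
have Dx0 : D (x + 0 *: h) by rewrite scale0r addr0.
have := @operator_convex_third_derivative R (fun t => f (x + t *: h))
  (fun t => 'D_h f (x + t *: h)) (fun t => 'D_h ('D_h f) (x + t *: h)) _ opl
  (fun t tl => is_derive_line1 (Dl t tl) (CkS (CkS fk)))
  (fun t tl => is_derive_line2 (Dl t tl) (CkS fk))
  (is_derive_line3 Dx0 fk).
by rewrite scale0r addr0.
Qed.

Lemma compatible x h : D x ->
  0 <= 'D_h ('D_h f) x /\
  `|'D_h ('D_h ('D_h f)) x| <=
    3 * 'D_h ('D_h f) x * Num.sqrt ('D_h ('D_h g) x).
Proof.
move=> Dx; have Gx : edom G x by rewrite edom_barrier.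
have gk : Ck 2 (edom G) g by exact: CkS (sc_C3 scG).
set b := 'D_h ('D_h f) x; set c := 'D_h ('D_h ('D_h f)) x.
set q := 'D_h ('D_h g) x.
have q0 : 0 <= q by exact: sc_hessian_ge0.
have scaled (r : R) : r ^+ 2 * q < 1 ->
    0 <= r ^+ 2 * b /\ r ^+ 3 * c <= 3 * (r ^+ 2 * b).
  move=> rq; have := @operator_convex_direction x (r *: h) Dx.
  rewrite (derive2_dirZ (sc_open_dom scG))// (derive2_dirZ oD)//;
    last exact: CkS.
  by rewrite (derive3_dirZ oD)//; exact.
(* The third derivative is odd in the direction and the second is even, so using both r and - r
   bounds the absolute value. *)
have rc (r : R) : 0 < r -> r * Num.sqrt q < 1 -> 0 <= b /\ r * `|c| <= 3 * b.
  move=> r0 rq; have rq1 : r ^+ 2 * q < 1.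
    by rewrite -[q]sqr_sqrtr// -exprMn expr_lt1// mulr_ge0 ?sqrtr_ge0// ltW.
  have [] := scaled r rq1; rewrite pmulr_rge0 ?exprn_gt0// => b0 h1.
  split => //.
  have := scaled (- r); rewrite sqrrN => /(_ rq1)[_ h2].
  have r2 : 0 < r ^+ 2 by rewrite exprn_gt0.
  rewrite -(ler_pM2l r2).
  have [c0|c0] := ger0P c; move: h1 h2; lra.
have y0 : 0 <= Num.sqrt q by exact: sqrtr_ge0.
set y := Num.sqrt q in rc y0 *.
have b0 : 0 <= b.
  (* This scale is admissible also when [y] is 0. *)
  have [||//] := rc (1 + y)^-1.
    by rewrite invr_gt0; lra.
  by rewrite mulrC ltr_pdivrMr; lra.
split => //; rewrite leNgt; apply/negP => hc.
have by0 : 0 <= 3 * b * y by rewrite !mulr_ge0.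
have c0 : 0 < `|c| by exact: le_lt_trans hc.
(* If the bound fails, [d] is positive and so small that r = (3 b + d) / |c| still satisfies r y <
   1, although r |c| = 3 b + d exceeds 3 b. No division by [y] occurs, so q = 0 is covered. *)
pose d := (`|c| - 3 * b * y) / (y + 1).
have d0 : 0 < d by rewrite divr_gt0//; lra.
have yd : y * d < `|c| - 3 * b * y.
  rewrite /d mulrCA gtr_pMr; last by lra.
  by rewrite ltr_pdivrMr; lra.
have [||_] := rc ((3 * b + d) / `|c|).
- by rewrite divr_gt0//; lra.
- by rewrite mulrAC ltr_pdivrMr// mul1r; lra.
by rewrite divfK ?gt_eqF//; lra.
Qed.

(** The segment lies in [D], the domain of the convex function [G]. There the second derivative is
    nonnegative, so the slope never falls below its initial value. *)
Lemma tangent_le x y : D x -> D y -> f x + 'D_(y - x) f x <= f y.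
Proof.
move=> Dx Dy; pose h := y - x.
have Dl (t : R) : 0 <= t <= 1 -> D (x + t *: h).
  rewrite -edom_barrier => t01.
  have -> : x + t *: h = t *: y + (1 - t) *: x.
    by rewrite /h scalerBr scalerBl scale1r addrCA.
  by apply: sc_convex_dom t01 => //; rewrite edom_barrier.
have dl (t : R) : 0 <= t <= 1 ->
    is_derive t 1 (fun s => 'D_h f (x + s *: h)) ('D_h ('D_h f) (x + t *: h)).
  by move=> /Dl Dt; exact: is_derive_line2 Dt (CkS fk).
have slope (t : R) : 0 <= t <= 1 -> 'D_h f x <= 'D_h f (x + t *: h).
  move=> /andP[t0 t1].
  have := @is_derive_ge0_le R (fun s => 'D_h f (x + s *: h))
    (fun s => 'D_h ('D_h f) (x + s *: h)) 0 t t0.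
  rewrite scale0r addr0; apply => u /andP[u0 ut].
    by apply: dl; rewrite u0 (le_trans ut).
  by apply: (compatible _ (Dl _ _)).1; rewrite u0 (le_trans ut).
have [c c01] := @is_derive_MVT R (fun s => f (x + s *: h))
  (fun s => 'D_h f (x + s *: h)) 0 1 ler01
  (fun t t01 => is_derive_line1 (Dl t t01) (CkS (CkS fk))).
rewrite scale0r scale1r addr0 subr0 mulr1 [x + h]addrC subrK => E.
by rewrite -lerBrDl E slope.
Qed.

(** The tangent inequalities at the intermediate point are averaged; the linear terms cancel. *)
Lemma f_convex x y (l : R) : D x -> D y -> 0 <= l <= 1 ->
  D (l *: x + (1 - l) *: y) /\
  f (l *: x + (1 - l) *: y) <= l * f x + (1 - l) * f y.
Proof.
move=> Dx Dy l01; set z := _ + _.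
have Dz : D z.
  by rewrite -edom_barrier; apply: sc_convex_dom => //; rewrite edom_barrier.
split => //; have /andP[l0 l1] := l01.
have df : differentiable f z by exact: Ck_differentiable fk Dz.
have hx := ler_wpM2l l0 (tangent_le Dz Dx).
have l10 : 0 <= 1 - l by lra.
have hy := ler_wpM2l l10 (tangent_le Dz Dy).
have E : l * 'D_(x - z) f z + (1 - l) * 'D_(y - z) f z = 0.
  rewrite !deriveE// -![_ * 'd f z _]/(_ *: 'd f z _) -!linearZ -linearD /=.
  rewrite !scalerBr addrACA -/z -opprD -scalerDl [l + _]addrC subrK.
  by rewrite scale1r subrr linear0.
by lra.
Qed.

End Compatibility.

(** * Scalar inequalities and concavity of the logarithm *)

Section RealInequalities.
Variable R : realType.

(* [2 s ^ (3 / 2)] lies above its tangent [3 m s - m ^+ 3] at [m ^+ 2], for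
   [m = a + b] and [s = a ^+ 2 + b ^+ 2 + w]. *)
Lemma barrier_inequality (a b w : R) : 0 <= a -> 0 <= b -> 0 <= w ->
  3 * w * (a + b) + 2 * a ^+ 3 + 2 * b ^+ 3 <=
  2 * (a ^+ 2 + b ^+ 2 + w) `^ (3 / 2).
Proof.
move=> a0 b0 w0.
have s0 : 0 <= a ^+ 2 + b ^+ 2 + w by rewrite !addr_ge0 ?sqr_ge0.
rewrite powR32//; set s := Num.sqrt _.
have sE : a ^+ 2 + b ^+ 2 + w = s ^+ 2 by rewrite sqr_sqrtr.
have sp : 0 <= s by exact: sqrtr_ge0.
have -> : w = s ^+ 2 - a ^+ 2 - b ^+ 2 by lra.
rewrite (_ : a ^+ 2 + b ^+ 2 + _ = s ^+ 2); last by ring.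
pose m := a + b.
rewrite -subr_ge0.
have -> : 2 * (s ^+ 2 * s) - (3 * (s ^+ 2 - a ^+ 2 - b ^+ 2) * (a + b)
    + 2 * a ^+ 3 + 2 * b ^+ 3) = (s - m) ^+ 2 * (2 * s + m).
  by rewrite /m; ring.
by rewrite mulr_ge0 ?sqr_ge0// /m; lra.
Qed.

(** The logarithm lies strictly below its tangent at the mean [m], except at [m] itself, and the
    averaged linear terms cancel. *)
Lemma ln_strict_concave (a b l : R) : 0 < a -> 0 < b -> a != b -> 0 < l < 1 ->
  l * ln a + (1 - l) * ln b < ln (l * a + (1 - l) * b).
Proof.
move=> a0 b0 ab /andP[l0 l1]; set m := l * a + _.
have l10 : 0 < 1 - l by lra.
have m0 : 0 < m by rewrite addr_gt0// mulr_gt0.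
have lt1 (c : R) : 0 < c -> c != m -> ln c - ln m < c / m - 1.
  move=> c0 cm; rewrite -ln_div ?posrE//.
  have cm1 : ln (c / m) != 0.
    rewrite ln_eq0 ?divr_gt0//; apply: contra cm => /eqP h.
    by rewrite -[c](divfK (lt0r_neq0 m0)) h mul1r.
  by have := expR_gt1Dx cm1; rewrite lnK ?posrE ?divr_gt0//; lra.
have am : a != m.
  apply: contra ab => /eqP h; apply/eqP; apply: (mulfI (lt0r_neq0 l10)).
  by move: h; rewrite /m; lra.
have bm : b != m.
  apply: contra ab => /eqP h; apply/eqP; apply: (mulfI (lt0r_neq0 l0)).
  by move: h; rewrite /m; lra.
have ha : l * (ln a - ln m) < l * (a / m - 1) by rewrite ltr_pM2l// lt1.
have hb : (1 - l) * (ln b - ln m) < (1 - l) * (b / m - 1).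
  by rewrite ltr_pM2l// lt1.
have E : l * (a / m - 1) + (1 - l) * (b / m - 1) = 0.
  by rewrite /m; field; rewrite -/m lt0r_neq0.
by lra.
Qed.

Lemma ln_concave (a b l : R) : 0 < a -> 0 < b -> 0 < l < 1 ->
  l * ln a + (1 - l) * ln b <= ln (l * a + (1 - l) * b).
Proof.
move=> a0 b0 l01; have [->|ab] := eqVneq a b.
  by rewrite -!mulrDl addrC subrK !mul1r.
by rewrite ltW// ln_strict_concave.
Qed.

End RealInequalities.

(** * The barrier of the epigraph *)

Section EpigraphBarrier.
Variables (R : realType) (V : normedModType R) (D : set V) (f : V -> R)
  (G : V -> \bar R).
Hypotheses (oD : open D) (fk : Ck 3 D f) (scG : self_concordant G).
Hypothesis clG : closure (edom G) = closure D.
Hypothesis opf : forall x h : V,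
  D x -> closure D (x + h) -> closure D (x - h) ->
  (forall t : R, -1 < t < 1 -> D (x + t *: h)) /\
  operator_convex (-1) 1 (fun t : R => f (x + t *: h)).

Local Notation g := (fine \o G).
Let F := fun p : R * V =>
  if p.2 \in D then (- lne (p.1 - f p.2)%R%:E + G p.2)%E else +oo%E.
Let Q := [set p : R * V | D p.2 /\ f p.2 < p.1].
Let u (p : R * V) := p.1 - f p.2.

Let GD : edom G = D. Proof. exact: (edom_barrier oD scG clG opf). Qed.

Let GE x : D x -> G x = (g x)%:E.
Proof. by rewrite -GD; exact: edomE. Qed.

Let FE p : Q p -> F p = (- ln (u p) + g p.2)%:E.
Proof.
move=> [Dp fp]; rewrite /F mem_set// GE// lne_EFin ?subr_gt0//.
Qed.

Let FNQ p : ~ Q p -> F p = +oo%E.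
Proof.
move=> nQ; rewrite /F; case: ifPn => // /set_mem Dp.
by rewrite GE//= subr_le0 leNgt; case: ifPn => // /negPn fp; case: nQ.
Qed.

Let edomQ : edom F = Q.
Proof.
apply/seteqP; split => p; rewrite /edom /=; last by move=> /FE ->; exact: ltry.
by apply: contraPP => /FNQ ->; rewrite ltxx.
Qed.

Let u_gt0 p : Q p -> 0 < u p. Proof. by move=> [_]; rewrite subr_gt0. Qed.

Let oQ : open Q.
Proof.
rewrite openE => p [Dp fp].
have uc : u q @[q --> p] --> u p.
  apply: cvgB; first exact: cvg_fst.
  apply: (@continuous_comp _ _ _ (@snd R V) f); first exact: cvg_snd.
  by apply: differentiable_continuous; exact: Ck_differentiable fk Dp.
have up : 0 < u p by rewrite subr_gt0.
near=> q; split.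
  by near: q; apply: (@cvg_snd _ _ (nbhs p.1) (nbhs p.2)); exact: open_near.
by rewrite -subr_gt0; near: q; apply: (cvgr_gt _ uc).
Unshelve. all: by end_near. Qed.

Let uk : Ck 3 Q u.
Proof.
apply: (CkD oQ); first exact: Ck_fst.
apply: (CkN oQ); apply: (@Ck_sub _ _ Q [set p | D p.2]) => [p []//|].
exact: Ck_comp_snd.
Qed.

Let gk : Ck 3 D g. Proof. by rewrite -GD; exact: sc_C3. Qed.

Let Fk : Ck 3 Q (fine \o F).
Proof.
apply: (@Ck_ext _ _ Q oQ _ (fun p => - ln (u p) + g p.2)).
  by move=> p Qp; rewrite /= FE.
apply: (CkD oQ); first exact: (CkN oQ (Ck_ln oQ u_gt0 uk)).
apply: (@Ck_sub _ _ Q [set p | D p.2]) => [p []//|].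
exact: Ck_comp_snd.
Qed.

(** Exponentiating removes the logarithm: positivity of [u] becomes automatic, and over [D] the
    condition is a weak inequality between continuous functions. *)
Let epiFP (q : R * (R * V)) :
  epi F q <-> D q.2.2 /\ expR (g q.2.2 - q.1) <= u q.2.
Proof.
rewrite /epi /=; split=> [h|[Dq h]].
  have Qq : Q q.2.
    by apply: contrapT => /FNQ E; move: h; rewrite E leye_eq.
  split; first by case: Qq.
  move: h; rewrite FE// lee_fin => h.
  rewrite -[leRHS]lnK ?posrE ?u_gt0// ler_expR.
  rewrite -[fine _]/(g q.2.2).
  by move: (g q.2.2) (ln (u q.2)) h => gq l; lra.
have Qq : Q q.2 by split=> //; rewrite -subr_gt0 (lt_le_trans (expR_gt0 _) h).
rewrite FE// lee_fin.
move: h; rewrite -[leRHS]lnK ?posrE ?u_gt0// ler_expR.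
rewrite -[fine _]/(g q.2.2).
by move: (g q.2.2) (ln (u q.2)) => gq l; lra.
Qed.

(** Limits are taken along the trace of the neighbourhoods of [z] on the epigraph. Once the limit is
    known to lie over [D], continuity carries the inequality over. *)
Let closed_epiF : closed (epi F).
Proof.
move=> z cz.
have PF : ProperFilter (within (epi F) (nbhs z)) by exact: within_nbhs_proper.
have [q0 [/epiFP[Dx0 _] _]] := cz _ filterT.
set x0 := q0.2.2 in Dx0.
(* [f] lies above its tangent at [x0], so [u] is locally bounded above. *)
have lowf (q : R * (R * V)) : D q.2.2 ->
    u q.2 <= q.2.1 - (f x0 + 'd f x0 (q.2.2 - x0)).
  move=> Dq; rewrite /u lerD2l lerN2 -deriveE.
    exact: (tangent_le oD fk scG clG opf).
  exact: Ck_differentiable fk Dx0.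
have c1 : (q.1 : R) @[q --> z] --> z.1 by exact: cvg_fst.
have c2 : q.2 @[q --> z] --> z.2 by exact: cvg_snd.
have c21 : q.2.1 @[q --> z] --> z.2.1.
  have cf : (fun p : R * V => p.1) @ z.2 --> z.2.1 by exact: cvg_fst.
  exact: (cvg_comp _ _ c2 cf).
have c22 : q.2.2 @[q --> z] --> z.2.2.
  have cs : (fun p : R * V => p.2) @ z.2 --> z.2.2 by exact: cvg_snd.
  exact: (cvg_comp _ _ c2 cs).
pose c (q : R * (R * V)) := q.1 + (q.2.1 - (f x0 + 'd f x0 (q.2.2 - x0))).
have cc : c q @[q --> z] --> c z.
  apply: cvgD => //; apply: cvgB => //; apply: cvgD; first exact: cvg_cst.
  apply: (@continuous_comp _ _ _ (fun q : R * (R * V) => q.2.2 - x0) ('d f x0)).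
    by apply: cvgB => //; exact: cvg_cst.
  exact/diff_continuous/(Ck_differentiable fk).
(* On the epigraph, G <= q.1 + ln u < q.1 + u <= c q with [c] continuous, so closedness of the
   epigraph of [G] gives a finite value of [G] at the limit. *)
have Dz : D z.2.2.
  have : epi G (c z, z.2.2).
    apply: (@closed_cvg _ _ (within (epi F) (nbhs z)) PF
      (fun q => (c q, q.2.2)) _ (sc_closed scG)); last first.
      apply: cvg_within_filter.
      exact: (@cvg_pair _ _ _ (nbhs z) (nbhs (c z)) (nbhs z.2.2)).
    rewrite near_withinE; near=> q => /epiFP[Dq h].
    rewrite /epi /= GE// lee_fin.
    have uq : 0 < u q.2 by exact: lt_le_trans (expR_gt0 _) h.
    have := lowf q Dq; have := ln_sublinear uq.
    move: h; rewrite -[leRHS]lnK ?posrE// ler_expR /c /=.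
    by move: ('d f x0 _) => d; lra.
  rewrite /epi /= => h; rewrite -GD /edom /=.
  by apply: le_lt_trans h _; rewrite ltry.
apply/epiFP; split => //.
have dc (k : V -> R) : Ck 3 D k -> k q.2.2 @[q --> z] --> k z.2.2.
  move=> kk.
  apply: (@continuous_comp _ _ _ (fun q : R * (R * V) => q.2.2) k) => //.
  exact/differentiable_continuous/(Ck_differentiable kk).
have : u q.2 - expR (g q.2.2 - q.1) @[q --> z] --> u z.2 - expR (g z.2.2 - z.1).
  apply: cvgB; first by apply: cvgB => //; exact: dc.
  apply: (@continuous_comp _ _ _
    (fun q : R * (R * V) => g q.2.2 - q.1) (@expR R)); last first.
    exact: continuous_expR.
  by apply: cvgB => //; exact: dc.
move=> /(@cvg_within_filter _ _ _ _ _ _ (epi F)) /cvgr_to_ge h.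
rewrite -subr_ge0; apply: h; rewrite near_withinE.
by near=> q => /epiFP[_]; rewrite subr_ge0.
Unshelve. all: by end_near. Qed.

(** If the components in [V] differ, strictness comes from [G]. If they agree, the values of [u]
    differ and it comes from the logarithm. *)
Let strictF : strictly_convex F.
Proof.
move=> p q l; rewrite edomQ => Qp Qq pq l01.
have [[Dp fp] [Dq fq]] := (Qp, Qq); have /andP[l0 l1] := l01.
have l10 : 0 < 1 - l by lra.
have l01' : 0 <= l <= 1 by rewrite !ltW.
have [Dz fz] := f_convex oD fk scG clG opf Dp Dq l01'.
set z := l *: p + (1 - l) *: q.
have uz : l * u p + (1 - l) * u q <= u z.
  by rewrite /u /z /= /GRing.scale /=; move: fz; lra.
have up := u_gt0 Qp; have uq := u_gt0 Qq.
have m0 : 0 < l * u p + (1 - l) * u q by rewrite addr_gt0// mulr_gt0.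
have Qz : Q z by split=> //; rewrite -subr_gt0 (lt_le_trans m0 uz).
rewrite !FE// -!EFinM -EFinD lte_fin.
have lnz : ln (l * u p + (1 - l) * u q) <= ln (u z).
  by rewrite ler_ln ?posrE// (lt_le_trans m0).
have [pq2|pq2] := eqVneq p.2 q.2.
  have gz : g z.2 = g p.2.
    by rewrite /z /= pq2 -scalerDl addrC subrK scale1r.
  have upq : u p != u q.
    apply: contra pq => /eqP h; apply/eqP; case: p q pq2 h {Qp Qq Dp Dq fp fq
      Dz fz z uz up uq m0 Qz lnz gz} => [p1 p2] [q1 q2] /= -> h.
    by congr pair; move: h; rewrite /u /=; lra.
  have := ln_strict_concave up uq upq l01; rewrite gz -pq2.
  move: (g p.2) => gp; lra.
have := ln_concave up uq l01.
have Gp : edom G p.2 by rewrite GD.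
have Gq : edom G q.2 by rewrite GD.
have [_] := sc_strict_convex scG Gp Gq pq2 l01.
rewrite -[(l *: p.2 + _)]/(z.2).
move: (g z.2) (g p.2) (g q.2) => gz gp gq; lra.
Qed.

Section Derivatives.
Variable h : R * V.
Local Notation e := h.2.

(* Along [h], the first three derivatives of [u] at [p] are [u1 p],
   [r2 p * u p] and [r3 p * u p]. *)
Let u1 (p : R * V) : R := h.1 - 'D_e f p.2.
Let r (p : R * V) : R := u1 p * (u p)^-1.
Let r2 (p : R * V) : R := - 'D_e ('D_e f) p.2 * (u p)^-1.
Let r3 (p : R * V) : R := - 'D_e ('D_e ('D_e f)) p.2 * (u p)^-1.

Let derivable_comp_snd k (w : V -> R) p : Ck k.+1 D w -> Q p ->
  is_derive p h (fun q => w q.2) ('D_e w p.2).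
Proof.
move=> wk [Dp _]; apply: is_derive_comp_snd.
exact/diff_derivable/(Ck_differentiable wk).
Qed.

Let du p : Q p -> is_derive p h u (u1 p).
Proof.
move=> Qp; have d1 := is_derive_fst p h; have d2 := derivable_comp_snd fk Qp.
exact: is_deriveB.
Qed.

(** The quotient rule, arranged so that derivatives of [r] and [r2] are again polynomials in [r],
    [r2], [r3]. *)
Let dquot (v : R * V -> R) (dv : R) p : Q p -> is_derive p h v dv ->
  is_derive p h (fun q => v q * (u q)^-1)
    (dv * (u p)^-1 - v p * (u p)^-1 * r p).
Proof.
move=> Qp dvp; have un0 := lt0r_neq0 (u_gt0 Qp).
have dup := du Qp.
have dV : is_derive p h (fun q => (u q)^-1) (- (u p) ^- 2 * u1 p).
  apply: DeriveDef; first by apply: derivableV => //; exact: ex_derive.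
  by rewrite deriveV// derive_val.
apply: (is_derive_eq (is_deriveM dvp dV)).
by rewrite /GRing.scale /= /r; field.
Qed.

Let dr p : Q p -> is_derive p h r (r2 p - r p * r p).
Proof.
move=> Qp; apply: dquot => //.
have d2 := derivable_comp_snd (Ck_derive e fk) Qp.
have d1 : is_derive p h (fun=> h.1) (0 : R) by exact: is_derive_cst.
by apply: (is_derive_eq (is_deriveB d1 d2)); rewrite sub0r.
Qed.

Let dr2 p : Q p -> is_derive p h r2 (r3 p - r2 p * r p).
Proof.
move=> Qp; apply: dquot => //.
have d2 := derivable_comp_snd (Ck_derive e (Ck_derive e fk)) Qp.
exact: is_deriveN.
Qed.

Let dF p : Q p -> is_derive p h (fine \o F) (- r p + 'D_e g p.2).
Proof.
move=> Qp; apply: (@near_eq_is_derive _ _ _ (fun q => - ln (u q) + g q.2)).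
  near=> q; have Qq : Q q by near: q; exact: (open_near oQ Qp).
  by rewrite /= FE.
have d2 := derivable_comp_snd gk Qp.
have up : differentiable u p by exact: Ck_differentiable uk Qp.
have d1 := is_derive_ln h (u_gt0 Qp) up.
have := is_deriveD (is_deriveN d1) d2.
by have [_ ->] := du Qp.
Unshelve. all: by end_near. Qed.

Let dF1 p : Q p ->
  is_derive p h ('D_h (fine \o F)) (- (r2 p - r p * r p) + 'D_e ('D_e g) p.2).
Proof.
move=> Qp; apply: (@near_eq_is_derive _ _ _ (fun q => - r q + 'D_e g q.2)).
  near=> q; have Qq : Q q by near: q; exact: (open_near oQ Qp).
  by have [_ ->] := dF Qq.
have d2 := derivable_comp_snd (Ck_derive e gk) Qp.
exact: is_deriveD (is_deriveN (dr Qp)) d2.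
Unshelve. all: by end_near. Qed.

Let dF2 p : Q p -> is_derive p h ('D_h ('D_h (fine \o F)))
  (- (r3 p - r2 p * r p - 2 * r p * (r2 p - r p * r p))
   + 'D_e ('D_e ('D_e g)) p.2).
Proof.
move=> Qp; apply: (@near_eq_is_derive _ _ _
    (fun q => - (r2 q - r q * r q) + 'D_e ('D_e g) q.2)).
  near=> q; have Qq : Q q by near: q; exact: (open_near oQ Qp).
  by have [_ ->] := dF1 Qq.
have d2 := derivable_comp_snd (Ck_derive e (Ck_derive e gk)) Qp.
have d1 := is_deriveB (dr2 Qp) (is_deriveM (dr Qp) (dr Qp)).
apply: (is_derive_eq (is_deriveD (is_deriveN d1) d2)).
by rewrite /GRing.scale /=; congr (- _ + _); ring.
Unshelve. all: by end_near. Qed.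

Let compatF p : Q p -> 0 <= - r2 p /\
  `|r3 p| <= 3 * - r2 p * Num.sqrt ('D_e ('D_e g) p.2).
Proof.
move=> Qp; have [b0 cb] := compatible oD fk scG clG opf e Qp.1.
have up := u_gt0 Qp.
have iu : 0 < (u p)^-1 by rewrite invr_gt0.
rewrite /r2 mulNr opprK; split; first by rewrite mulr_ge0// ltW.
rewrite /r3 normrM normrN (gtr0_norm iu).
apply: le_trans (ler_wpM2r (ltW iu) cb) _.
by rewrite le_eqVlt; apply/orP; left; apply/eqP; ring.
Qed.

Lemma sc_ineq_epi p : Q p ->
  `|'D_h ('D_h ('D_h (fine \o F))) p|
    <= 2 * ('D_h ('D_h (fine \o F)) p) `^ (3 / 2).
Proof.
move=> Qp; have [_ ->] := dF2 Qp; have [_ ->] := dF1 Qp.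
have [b0 cb] := compatF Qp.
have Gp : edom G p.2 by rewrite GD; case: Qp.
have G20 : 0 <= 'D_e ('D_e g) p.2 by exact: sc_hessian_ge0.
have g3 := sc_ineq scG e Gp; rewrite powR32// in g3.
set y := Num.sqrt _ in cb g3.
have y0 : 0 <= y by exact: sqrtr_ge0.
have y2 : 'D_e ('D_e g) p.2 = y ^+ 2 by rewrite sqr_sqrtr.
rewrite y2 in g3 *.
(* Here a = |r|, b = y and w = - r2, so a^2 + b^2 + w is the second derivative. The third is - r3 +
   3 r r2 - 2 r^3 + D^3G, whose terms are at most 3 w b, 3 w a, 2 a^3 and 2 b^3 in absolute
   value. *)
have := barrier_inequality (normr_ge0 (r p)) y0 b0.
rewrite real_normK ?num_real//.
rewrite (_ : r p ^+ 2 + y ^+ 2 + - r2 p = - (r2 p - r p * r p) + y ^+ 2);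
  last by ring.
apply: le_trans.
move: (r3 p) (r2 p) (r p) ('D_e ('D_e ('D_e g)) p.2) b0 cb g3.
move=> c b a d b0 cb g3.
rewrite (_ : - _ + d = - c + (- b * (- (3 * a))) + (- (2 * a ^+ 3)) + d);
  last by ring.
have n1 : `|- b * (- (3 * a))| = - b * (3 * `|a|).
  by rewrite normrM (ger0_norm b0) normrN normrM [`|3|]ger0_norm.
have n2 : `|- (2 * a ^+ 3)| = 2 * `|a| ^+ 3.
  by rewrite normrN normrM normrX [`|2|]ger0_norm.
apply: le_trans (ler_normD _ _) _; rewrite -lerBrDr.
apply: le_trans (ler_normD _ _) _; rewrite -lerBrDr.
apply: le_trans (ler_normD _ _) _.
rewrite n1 n2 normrN.
by move: cb g3; rewrite (_ : y ^+ 2 * y = y ^+ 3); [lra|ring].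
Qed.

(** The logarithmic term contributes - 2 r - r^2 + r2, which is at most 1 because (r + 1)^2 >= 0 and
    r2 <= 0. *)
Lemma barrier_ineq_epi nu p :
  (forall x k, edom G x -> 2 * 'D_k g x - 'D_k ('D_k g) x <= nu) -> Q p ->
  2 * 'D_h (fine \o F) p - 'D_h ('D_h (fine \o F)) p <= 1 + nu.
Proof.
move=> Gnu Qp; have [_ ->] := dF1 Qp; have [_ ->] := dF Qp.
have [b0 _] := compatF Qp.
have Gp : edom G p.2 by rewrite GD; case: Qp.
have := Gnu _ e Gp; have := sqr_ge0 (r p + 1).
move: (r2 p) (r p) ('D_e g p.2) ('D_e ('D_e g) p.2) b0 => b a g1 g2 b0.
by rewrite sqrrD1; move: (a * a) (a ^+ 2) (expr2 a) => a2 _ ->; lra.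
Qed.

End Derivatives.

(** Raising the first coordinate by an arbitrarily small positive amount moves a point of the
    epigraph into the strict epigraph. *)
Let closureQ : closure Q = closure (epi_on D f).
Proof.
apply/seteqP; split.
  by apply: closureS => p [Dp fp]; split => //; exact: ltW.
have /closure_id -> := @closed_closure _ Q.
apply: closureS => p [Dp fp] B Bp.
have cp : (p.1 + t, p.2) @[t --> (0 : R)^'+] --> (p.1, p.2).
  apply: (@cvg_pair _ _ _ ((0 : R)^'+) (nbhs p.1) (nbhs p.2)).
    apply: cvg_at_right_filter; rewrite -[X in _ --> X]addr0.
    by apply: cvgD; [exact: cvg_cst|exact: cvg_id].
  exact: cvg_cst.
have [t [Bt t0]] : exists t : R, B (p.1 + t, p.2) /\ 0 < t.
  have := @filter_ex _ _ (at_right_proper_filter (0 : R))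
    [set t | B (p.1 + t, p.2) /\ 0 < t].
  apply; near=> t; split; last by near: t; exact: nbhs_right_gt.
  by near: t; apply: cp; rewrite -surjective_pairing.
by exists (p.1 + t, p.2); split => //; split => //=; lra.
Unshelve. all: by end_near. Qed.

Lemma sc_barrier_epi nu :
  (forall x k, edom G x -> 2 * 'D_k g x - 'D_k ('D_k g) x <= nu) ->
  sc_barrier (1 + nu) F (closure (epi_on D f)).
Proof.
move=> Gnu; split; last 2 first.
- by rewrite edomQ closureQ.
- by move=> p h; rewrite edomQ => Qp; exact: barrier_ineq_epi.
split.
- move=> p; have [Qp|/FNQ ->//] := pselect (Q p).
  by rewrite FE.
- by rewrite edomQ.
- by rewrite edomQ; exact: Fk.
- exact: closed_epiF.
- exact: strictF.
- by move=> p h; rewrite edomQ; exact: sc_ineq_epi.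
Qed.

End EpigraphBarrier.

Theorem theorem1p1 (R : realType) (V : finNormedModType R)
    (D : set V) (f : V -> R) (G : V -> \bar R) (nu : R) :
  open D ->
  Ck 3 D f ->
  (forall x h : V, D x -> closure D (x + h) -> closure D (x - h) ->
     (forall t : R, -1 < t < 1 -> D (x + t *: h)) /\
     operator_convex (-1) 1 (fun t : R => f (x + t *: h))) ->
  sc_barrier nu G (closure D) ->
  sc_barrier (1 + nu)
    (fun p : R * V =>
       if p.2 \in D then (- lne (p.1 - f p.2)%R%:E + G p.2)%E else +oo%E)
    (closure (epi_on D f)).
Proof. by move=> oD fk opf [scG clG Gnu]; exact: sc_barrier_epi. Qed.
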